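(* Let $X$ be a metric space and $a,b\in X$. Suppose $0<\ell<m_X$ and $d(a,b)\le\ell$. (1) There is a homeomorphism $$\mathcal{M}^\ell(X;a,b)\approx\bigvee_{F=(a_0,\dots,a_m)}\mathcal{M}^\ell(X;F),$$ where $F=(a_0,\dots,a_m)$ ($m\ge 0$) runs over all singular sequences of length $d(F)=\ell$ from $a=a_0$ to $b=a_m$. (2) Let $F=(a_0,\dots,a_m)$ be a singular sequence in $X$ with $0<d(F)<m_X$. Then there is a homotopy equivalence $$\mathcal{M}^{d(F)}(X;F)\simeq\bigwedge_{i=1}^m\mathcal{M}^{d(a_{i-1},a_i)}(X;a_{i-1},a_i).$$
   Context: For points $x_0,\dots,x_n$ of a metric space write $d(x_0,\dots,x_n)=\sum_{i=1}^n d(x_{i-1},x_i)$. A sequence is a tuple $\boldsymbol{x}=(x_0,\dots,x_n)$ with $x_{i-1}\ne x_i$ for all $i$; its length is $d(\boldsymbol{x})=d(x_0,\dots,x_n)$. Magnitude homotopy type. The causal order on $X\times\mathbb{R}$ is $(x,t)\le(x',t')$ iff $d(x,x')\le t'-t$. $\mathrm{Cau}^\ell(X;a,b)=\{(x,t)\in X\times[0,\ell]\mid d(a,x)\le t,\ d(x,b)\le\ell-t\}$. $\Delta P$ is the order complex of a poset $P$ (simplices are finite nonempty chains). $\Delta'\mathrm{Cau}^\ell(X;a,b)$ is the subcomplex of $\Delta\mathrm{Cau}^\ell(X;a,b)$ of chains $(x_0,t_0)<\dots<(x_n,t_n)$ with $d(x_0,\dots,x_n)<\ell$. $\mathcal{M}^\ell(X;a,b)=|\Delta\mathrm{Cau}^\ell(X;a,b)|/|\Delta'\mathrm{Cau}^\ell(X;a,b)|$,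 a pointed CW complex (with $Y/\emptyset=Y\sqcup\{*\}$, $\emptyset/\emptyset=\{*\}$). An empty wedge is a point. Smooth and singular points. In a sequence $(x_0,\dots,x_n)$, the point $x_k$ is smooth if $1\le k\le n-1$ and $d(x_{k-1},x_k,x_{k+1})=d(x_{k-1},x_{k+1})$; otherwise it is singular (in particular the end points are singular). A sequence all of whose points are singular is a singular sequence. The frame $\varphi(\boldsymbol{x})$ of a sequence $\boldsymbol{x}$ is the tuple of all its singular points, in order. 4-cuts. A sequence $(x_0,x_1,x_2,x_3)$ is a $4$-cut if $d(x_0,x_3)<d(x_0,x_1,x_2,x_3)=d(x_0,x_2,x_3)=d(x_0,x_1,x_3)$. $m_X=\inf\{d(\boldsymbol{x})\mid\boldsymbol{x}\text{ is a }4\text{-cut in }X\}$, with $m_X=\infty$ if there are no $4$-cuts. Framed magnitude homotopy type. For a singular sequence $F=(a_0,\dots,a_m)$ with $d(F)=\ell<m_X$, let $S(X;F)$ be the set of simplices $((x_0,t_0),\dots,(x_n,t_n))\in\Delta\mathrm{Cau}^\ell(X;a_0,a_m)$ such that $(x_0,\dots,x_n)$ is a sequence with $\varphi(x_0,\dots,x_n)=F$. Then $S(X;F)\cup\Delta'\mathrm{Cau}^\ell(X;a_0,a_m)$ is a simplicial complex, and $$\mathcal{M}^\ell(X;F)=\frac{|S(X;F)\cup\Delta'\mathrm{Cau}^\ell(X;a_0,a_m)|}{|\Delta'\mathrm{Cau}^\ell(X;a_0,a_m)|}.$$ *)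

(* Defs.v *)
From HB Require Import structures.
From mathcomp Require Import all_boot all_order all_algebra finmap.
From mathcomp Require Import all_classical all_reals all_analysis.

Set Implicit Arguments.
Unset Strict Implicit.
Unset Printing Implicit Defensive.

Import Order.TTheory GRing.Theory Num.Theory.
Import numFieldNormedType.Exports.

Local Open Scope classical_set_scope.
Local Open Scope ring_scope.

(* [collapse A] is T/A: the base point [None] stands for the class of A, and  *)
(* the topology is the final one for [collapse_pi].  When A is empty nothing  *)
(* is mapped to [None], which is then open and closed, so that T/set0 is the  *)
(* disjoint union of T and a point.                                           *)
Definition collapse (T : topologicalType) (A : set T) : Type :=
  option (set_type (~` A)).

Definition collapse_pi (T : topologicalType) (A : set T) (x : T) :
    collapse A :=
  insub x.

Section collapse_topology.
Context {T : topologicalType} {A : set T}.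

HB.instance Definition _ :=
  Choice.copy (collapse A) (option (set_type (~` A))).

Definition collapse_open (U : set (collapse A)) : Prop :=
  open (@collapse_pi T A @^-1` U).

Let collapse_openT : collapse_open setT.
Proof. by rewrite /collapse_open preimage_setT; exact: openT. Qed.

Let collapse_openI : setI_closed collapse_open.
Proof. by move=> U V; exact: openI. Qed.

Let collapse_open_bigU (I : Type) (f : I -> set (collapse A)) :
  (forall i, collapse_open (f i)) -> collapse_open (\bigcup_i f i).
Proof. by move=> fo; apply: bigcup_open => i _; exact: fo. Qed.

HB.instance Definition _ := @isOpenTopological.Build (collapse A)
  collapse_open collapse_openT collapse_openI collapse_open_bigU.

HB.instance Definition _ := isPointed.Build (collapse A) None.

End collapse_topology.

(* The compactly generated topology on T: a set is open when its trace on     *)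
(* every compact subset K is open in K.  It is only used for Hausdorff T.     *)
Definition kspace (T : topologicalType) : Type := T.

Section kspace_topology.
Context {T : topologicalType}.

HB.instance Definition _ := Choice.copy (kspace T) T.

Definition kspace_open (U : set (kspace T)) : Prop :=
  forall K : set T, compact K -> open (U : set (subspace K)).

Let kspace_openT : kspace_open setT.
Proof. by move=> K _; exact: openT. Qed.

Let kspace_openI : setI_closed kspace_open.
Proof. by move=> U V oU oV K cK; apply: openI; [exact: oU|exact: oV]. Qed.

Let kspace_open_bigU (I : Type) (f : I -> set (kspace T)) :
  (forall i, kspace_open (f i)) -> kspace_open (\bigcup_i f i).
Proof. by move=> fo K cK; apply: bigcup_open => i _; exact: fo. Qed.

HB.instance Definition _ := @isOpenTopological.Build (kspace T)
  kspace_open kspace_openT kspace_openI kspace_open_bigU.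

End kspace_topology.

(* The disjoint union with all base points collapsed.  The library's [pwedge] *)
(* is empty for an empty index type, whereas an empty wedge must be a point.  *)
Definition wedge_sum (I : choiceType) (T : I -> ptopologicalType) :
    ptopologicalType :=
  collapse [set x : {i : I & T i} | projT2 x = point].

(* The product of the T i modulo the fat wedge.  As usual for CW complexes,   *)
(* the product carries the compactly generated topology, so that the smash    *)
(* product of CW complexes is a CW complex.                                   *)
Definition smash (I : finType) (T : I -> ptopologicalType) :
    ptopologicalType :=
  collapse [set f : kspace (prod_topology T) | exists i, f i = point].

Definition pointed_map (T U : ptopologicalType) (f : T -> U) : Prop :=
  continuous f /\ f point = point.

Definition homeomorphic (T U : ptopologicalType) : Prop :=
  exists (f : T -> U) (g : U -> T),
    [/\ pointed_map f, pointed_map g, cancel f g & cancel g f].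

Definition homotopic (R : realType) (T U : ptopologicalType) (f g : T -> U) :
    Prop :=
  exists H : T * R -> U,
    [/\ {within [set: T] `*` `[0, 1], continuous H},
        forall x, H (x, 0) = f x,
        forall x, H (x, 1) = g x &
        forall t, t \in `[0, 1] -> H (point, t) = point].

Definition homotopy_equivalent (R : realType) (T U : ptopologicalType) :
    Prop :=
  exists (f : T -> U) (g : U -> T),
    [/\ pointed_map f, pointed_map g,
        homotopic R (g \o f) id & homotopic R (f \o g) id].

(* The points of |K| are given by their barycentric coordinates; the support  *)
(* of a point is the simplex whose relative interior contains it.  K is any   *)
(* set of finite sets; |K| is the usual realization when K is a simplicial    *)
(* complex.                                                                   *)
Definition barycentric (R : realType) (V : choiceType) (K : set {fset V}) :
    set {fsfun V -> R with 0} :=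
  [set w | [/\ K (finsupp w), forall v, 0 <= w v &
               \sum_(v <- finsupp w) w v = 1]].

Definition realization (R : realType) (V : choiceType) (K : set {fset V}) :
    Type :=
  set_type (@barycentric R V K).

Section realization_topology.
Context {R : realType} {V : choiceType} {K : set {fset V}}.

HB.instance Definition _ :=
  Choice.copy (realization R K) (set_type (@barycentric R V K)).

Definition coords (w : realization R K) : {ptws V -> R} := fun v => val w v.

Definition closed_simplex (s : {fset V}) : set (realization R K) :=
  [set w | (finsupp (val w) `<=` s)%fset].

(* The weak (CW) topology: on each closed simplex, a finite-dimensional set,  *)
(* the product topology of {ptws V -> R} is the Euclidean one.                *)
Definition realization_open (U : set (realization R K)) : Prop :=
  forall s, K s -> exists2 B : set {ptws V -> R}, open B &
    U `&` closed_simplex s = coords @^-1` B `&` closed_simplex s.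

Let realization_openT : realization_open setT.
Proof. by move=> s _; exists setT; [exact: openT|rewrite preimage_setT]. Qed.

Let realization_openI : setI_closed realization_open.
Proof.
move=> U W oU oW s Ks.
have [B oB UB] := oU s Ks.
have [P oP WP] := oW s Ks.
exists (B `&` P); first exact: openI.
by rewrite preimage_setI -[closed_simplex s]setIid setIACA UB WP setIACA.
Qed.

Let realization_open_bigU (I : Type) (f : I -> set (realization R K)) :
  (forall i, realization_open (f i)) -> realization_open (\bigcup_i f i).
Proof.
move=> fo s Ks.
have /choice[B BP] : forall i, exists B : set {ptws V -> R}, open B /\
    f i `&` closed_simplex s = coords @^-1` B `&` closed_simplex s.
  by move=> i; have [B oB fB] := fo i s Ks; exists B.
exists (\bigcup_i B i); first by apply: bigcup_open => i _; case: (BP i).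
rewrite preimage_bigcup !setI_bigcupl.
by apply: eq_bigcupr => i _; case: (BP i).
Qed.

HB.instance Definition _ := @isOpenTopological.Build (realization R K)
  realization_open realization_openT realization_openI realization_open_bigU.

End realization_topology.

(* |K| / |L| for a subcomplex L of K. *)
Definition relative_realization (R : realType) (V : choiceType)
    (K L : set {fset V}) : ptopologicalType :=
  collapse [set w : realization R K | L (finsupp (val w))].

Definition chain_in d (T : porderType d) (P : set T) (v : T) (c : seq T) :
    Prop :=
  path <%O v c /\ {in v :: c, forall u, P u}.

Definition simplex (T : choiceType) (v : T) (c : seq T) : {fset T} :=
  [fset u in v :: c]%fset.

Definition order_complex d (T : porderType d) (P : set T) : set {fset T} :=
  [set s | exists v c, chain_in P v c /\ s = simplex v c].

(* As in the library's [path], a nonempty tuple (x_0, ..., x_n) is given by   *)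
(* its first point x = x_0 and the list s of the remaining ones.              *)

Section sequences.
Context {R : realType} {X : metricType R}.
Implicit Types (x : X) (s : seq X).

Definition len x s : R := \sum_(d <- pairmap mdist x s) d.

Definition is_sequence x s : bool := path (fun y z => y != z) x s.

Definition smooth x s (k : nat) : bool :=
  let p i := nth x (x :: s) i in
  [&& (0 < k)%N, (k < size s)%N &
      len (p k.-1) [:: p k; p k.+1] == mdist (p k.-1) (p k.+1)].

Definition singular_sequence x s : Prop :=
  is_sequence x s /\ forall k, (k <= size s)%N -> ~~ smooth x s k.

Definition frame x s : seq X :=
  [seq nth x (x :: s) k | k <- iota 0 (size s).+1 & ~~ smooth x s k].

Definition four_cut (x0 x1 x2 x3 : X) : Prop :=
  [/\ is_sequence x0 [:: x1; x2; x3],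
      mdist x0 x3 < len x0 [:: x1; x2; x3],
      len x0 [:: x1; x2; x3] = len x0 [:: x2; x3] &
      len x0 [:: x2; x3] = len x0 [:: x1; x3]].

End sequences.

(* [ereal_inf set0 = +oo] *)
Definition four_cut_inf (R : realType) (X : metricType R) : \bar R :=
  ereal_inf [set r | exists x0 x1 x2 x3 : X,
    four_cut x0 x1 x2 x3 /\ r = (len x0 [:: x1; x2; x3])%:E].

Definition event (R : realType) (X : metricType R) : Type := (X * R)%type.

Fact causal_display : Order.disp_t. Proof. exact: Order.Disp tt tt. Qed.

Section causal_order.
Context {R : realType} {X : metricType R}.

HB.instance Definition _ := Choice.copy (event X) (X * R)%type.

Definition causal_le (u v : event X) : bool := mdist u.1 v.1 <= v.2 - u.2.

Let causal_le_refl : reflexive causal_le.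
Proof. by move=> u; rewrite /causal_le mdistxx subrr. Qed.

Let causal_le_anti : antisymmetric causal_le.
Proof.
move=> [x t] [y r]; rewrite /causal_le/= => /andP[xy yx].
have tr : t = r.
  apply/eqP; rewrite eq_le -subr_ge0 -[X in _ && X]subr_ge0.
  by rewrite (le_trans _ xy) ?mdist_ge0// (le_trans _ yx) ?mdist_ge0.
move: xy; rewrite tr subrr => xy; congr (_, _).
by apply: mdist_positivity; apply/eqP; rewrite eq_le xy mdist_ge0.
Qed.

Let causal_le_trans : transitive causal_le.
Proof.
move=> [y r] [x t] [z q]; rewrite /causal_le/= => xy yz.
rewrite (le_trans (metric_triangle x y z))// (le_trans (lerD xy yz))//.
by rewrite addrC subrKA.
Qed.

HB.instance Definition _ := Order.Le_isPOrder.Build causal_display (event X)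
  causal_le_refl causal_le_anti causal_le_trans.

End causal_order.

Section magnitude.
Context {R : realType} {X : metricType R}.
Implicit Types (l : R) (a b : X).

Definition Cau l a b : set (event X) :=
  [set u | [/\ u.2 \in `[0, l], mdist a u.1 <= u.2 & mdist u.1 b <= l - u.2]].

Definition short_chains l a b : set {fset event X} :=
  [set s | exists v c, [/\ chain_in (Cau l a b) v c, s = simplex v c &
                           len v.1 [seq u.1 | u <- c] < l]].

Definition magnitude_type l a b : ptopologicalType :=
  relative_realization R (order_complex (Cau l a b)) (short_chains l a b).

(* Below, F = (a_0, ..., a_m) is given by a = a_0 and f = [:: a_1; ...; a_m]; *)
(* thus a_m = last a f.                                                       *)
Implicit Type f : seq X.

Definition framed_simplices a f : set {fset event X} :=
  [set s | exists v c,
    [/\ chain_in (Cau (len a f) a (last a f)) v c, s = simplex v c,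
        is_sequence v.1 [seq u.1 | u <- c] &
        frame v.1 [seq u.1 | u <- c] = a :: f]].

Definition framed_magnitude_type a f : ptopologicalType :=
  let D := short_chains (len a f) a (last a f) in
  relative_realization R (framed_simplices a f `|` D) D.

Definition singular_sequences l a b : set (seq X) :=
  [set f | [/\ singular_sequence a f, len a f = l & last a f = b]].

End magnitude.

(* Main.v *)
Require Import Defs.
From mathcomp Require Import all_boot all_order all_algebra finmap.
From mathcomp Require Import all_classical all_reals all_analysis.
From mathcomp Require Import lra.

(* A chain of Cau^l(X;a,b) of length at least l is determined by its points      *)
(* a = x_0, ..., x_n = b, which form a sequence of length l, since its times are *)
(* then the partial lengths. Below m_X, deleting a smooth point of a sequence    *)
(* does not change which of the other points are singular, so the frame is       *)
(* constant along the faces that are not short: this splits M^l(X;a,b) as a      *)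
(* wedge.                                                                        *)
(*                                                                               *)
(* The simplices of M(X;F) are the chains of the causal interval [A_0, A_m] that *)
(* contain all the events A_j = (a_j, d(a_0, ..., a_j)); cutting such a chain at *)
(* the A_j gives one chain in each interval [A_i, A_i+1], that is, after a       *)
(* translation in time, in Cau(X; a_i, a_i+1). Call y in |S(X;F)| and            *)
(* x in prod_i |Cau(X; a_i, a_i+1)| related when, for every i, the restriction   *)
(* of y to the i-th interval is proportional to x_i. Off the base points this is *)
(* a bijection, as x_i determines y on the i-th interval up to a factor and the  *)
(* value of y at A_i+1 links consecutive factors; moreover y lies in the         *)
(* collapsed subcomplex iff some x_i does. The relation is closed, so that the   *)
(* induced bijection of M(X;F) with the smash product is a homeomorphism: the    *)
(* (pre)image of a closed set meets each compact piece in the projection of a    *)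
(* compact set.                                                                  *)

Set Implicit Arguments.
Unset Strict Implicit.
Unset Printing Implicit Defensive.

Import Order.TTheory GRing.Theory Num.Theory.
Import numFieldNormedType.Exports.
Local Open Scope classical_set_scope.
Local Open Scope ring_scope.

(** * Collapses and products *)

(** Everything starts from [not_shortP]: the simplices that survive the collapse are exactly the
    light-like chains over sequences from a to b of length l.

    For (1), the bound m_X enters through [geodesic_four], from which [singular_points_remove] and
    [singular_points_subseq_eq] deduce that deleting points without changing the length does not
    change the frame. Hence surviving faces keep their frame ([framed_face]), and each frame is a
    singular sequence of length l ([singular_points_spec]). The surviving simplices fall into
    classes closed under surviving faces, and [wedge_homeomorphic] turns such a partition into a
    wedge.

    For (2), [framed_marksP] and [short_endsP] describe survival by vertices: a chain has frame F
    iff it passes through all the A_j, and a chain between consecutive points of F survives iff it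
    contains both ends. This lets [glue_homeomorphic] match barycentric coordinates up to scale. The
    topology is in [smash_homeomorphic]: closedness is tested on closed simplices on one side and on
    compact sets of the product on the other, and by [compact_finite_support] both tests involve
    finitely many vertices only. The result is a homeomorphism, which gives the homotopy equivalence
    with constant homotopies. *)

Section collapse_theory.
Context {T : topologicalType} {A : set T}.
Local Notation pi := (@collapse_pi T A).

Lemma collapse_pi_None x : pi x = None <-> A x.
Proof.
rewrite /collapse_pi; case: insubP => [u /set_mem Ax _|/negP nAx].
  by split=> // /Ax.
by split=> // _; apply: contrapT => /mem_set.
Qed.

Lemma collapse_pi_Some x (nAx : x \in ~` A) : pi x = Some (SigSub nAx).
Proof. by rewrite /collapse_pi insubT. Qed.

Lemma collapse_pi_val (z : set_type (~` A)) : pi (val z) = Some z.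
Proof. by rewrite /collapse_pi valK. Qed.

Lemma collapse_pi_inj x y : ~ A x -> pi x = pi y -> x = y.
Proof.
move=> nAx; rewrite (collapse_pi_Some (mem_set nAx)) => /esym.
rewrite /collapse_pi; case: insubP => // u _ <- [->] //.
Qed.

Lemma collapse_pi_surj (z : collapse A) : z = None \/ exists2 x, ~ A x & z = pi x.
Proof.
case: z => [u|]; [right|by left].
by exists (val u); [by apply: set_mem; exact: (valP u)|rewrite collapse_pi_val].
Qed.

Lemma collapse_closedP (Z : set (collapse A)) : closed Z <-> closed (pi @^-1` Z).
Proof. by rewrite -openC -[X in _ <-> X]openC. Qed.

Lemma collapse_continuousP (U : topologicalType) (f : collapse A -> U) :
  continuous (f \o pi) -> continuous f.
Proof.
by move=> /continuousP cf; apply/continuousP => B oB; have := cf B oB.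
Qed.

Lemma collapse_pi_continuous : continuous pi.
Proof. by apply/continuousP => B. Qed.

End collapse_theory.

Lemma hausdorff_separating (T U : topologicalType) : hausdorff_space U ->
  (forall p q : T, p <> q -> exists2 f : T -> U, continuous f & f p <> f q) ->
  hausdorff_space T.
Proof.
move=> hU sep p q pq; apply: contrapT => /sep[f cf]; apply; apply: hU => B C nB nC.
have [x [Bx Cx]] := pq _ _ (cf p _ nB) (cf q _ nC).
by exists (f x).
Qed.

Lemma continuous_image_compact (T U : topologicalType) (f : T -> U) (A : set T) :
  continuous f -> compact A -> compact (f @` A).
Proof. by move=> cf; apply: continuous_compact; exact: continuous_subspaceT. Qed.

Lemma continuous_mulr (R : realType) (T : topologicalType) (f g : T -> R) :
  continuous f -> continuous g -> continuous (fun x => f x * g x).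
Proof. by move=> cf cg x; apply: cvgM; [exact: cf|exact: cg]. Qed.

Lemma prod_topology_continuous (S : topologicalType) (I : eqType)
    (T : I -> topologicalType) (f : S -> prod_topology T) :
  (forall i, continuous (fun x => f x i)) -> continuous f.
Proof.
move=> cf x; apply/cvg_sup => i U.
rewrite nbhsE => -[W [[B oB <-] /= Bx] BU].
apply: (filterS BU); apply: (cf i x); exact: open_nbhs_nbhs.
Qed.

Lemma prod_map_continuous (I : eqType) (T U : I -> topologicalType)
    (f : forall i, T i -> U i) : (forall i, continuous (f i)) ->
  continuous (fun x : prod_topology T => (fun i => f i (x i)) : prod_topology U).
Proof.
move=> cf; apply: prod_topology_continuous => i x.
apply: (@continuous_comp _ _ _ (fun z : prod_topology T => z i) (f i)); last exact: cf.
exact: (@proj_continuous I T i).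
Qed.

(** * Realizations: coordinates, closed sets and compactness *)

Definition face_closed (V : choiceType) (K : set {fset V}) : Prop :=
  forall s t : {fset V}, K s -> (t `<=` s)%fset -> t != fset0 -> K t.

Section realization_theory.
Context {R : realType} {V : choiceType} {K : set {fset V}}.
Implicit Types (w : realization R K) (s t A : {fset V}).

Lemma coord_ge0 w v : 0 <= val w v.
Proof. by have [_ + _] := set_mem (valP w); exact. Qed.

Lemma supp_K w : K (finsupp (val w)).
Proof. by have [] := set_mem (valP w). Qed.

Lemma coord_gt0 w v : (0 < val w v) = (v \in finsupp (val w)).
Proof. by rewrite lt_neqAle coord_ge0 andbT eq_sym mem_finsupp. Qed.

Lemma sum_coords w A : (finsupp (val w) `<=` A)%fset -> \sum_(v <- A) val w v = 1.
Proof.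
move=> sA; have [_ _ <-] := set_mem (valP w).
apply/esym/big_fset_incl => // v vA.
by rewrite mem_finsupp negbK => /eqP.
Qed.

Lemma coord_le1 w v : val w v <= 1.
Proof.
have [vw|] := boolP (v \in finsupp (val w)); last first.
  by rewrite mem_finsupp negbK => /eqP ->.
rewrite -(@sum_coords w _ (fsubset_refl _)) (big_fsetD1 v)//= lerDl.
by apply: sumr_ge0 => u _; exact: coord_ge0.
Qed.

Lemma realization_inj w w' : (forall v, val w v = val w' v) -> w = w'.
Proof. by move=> ww'; apply/val_inj/fsfunP. Qed.

Lemma supp_exists w : exists v, v \in finsupp (val w).
Proof.
have /fset0Pn[v vw] : finsupp (val w) != fset0.
  apply/eqP => w0; have := sum_coords (fsubset_refl (finsupp (val w))).
  by rewrite w0 big_nil => /esym/eqP; rewrite oner_eq0.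
by exists v.
Qed.

(** The coordinates of a point sum to 1, so the two factors agree. Points can thus be compared up to
    scale. *)
Lemma realization_proportional w w' (b c : R) : b != 0 ->
  (forall v, b * val w v = c * val w' v) -> w = w'.
Proof.
move=> b0 ww'; have bc : b = c.
  pose A := (finsupp (val w) `|` finsupp (val w'))%fset.
  rewrite -[LHS]mulr1 -[RHS]mulr1.
  rewrite -{1}(@sum_coords w A) ?fsubsetUl// -(@sum_coords w' A) ?fsubsetUr//.
  by rewrite !mulr_sumr; apply: eq_bigr => v _.
by apply: realization_inj => v; apply: (mulfI b0); rewrite ww' bc.
Qed.

Lemma realization_mk s (g : V -> R) : (forall v, v \in s -> 0 <= g v) ->
  \sum_(v <- s) g v = 1 -> K [fset v in s | g v != 0]%fset ->
  exists w, forall v, val w v = if v \in s then g v else 0.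
Proof.
move=> g0 g1 Kg; pose h : {fsfun V -> R with 0} := [fsfun v in s => g v].
have hE v : h v = if v \in s then g v else 0 by rewrite fsfunE.
have sh : finsupp h = [fset v in s | g v != 0]%fset.
  apply/fsetP => v; rewrite mem_finsupp hE !inE /=.
  by case: ifP => //=; rewrite eqxx.
have bh : barycentric K h.
  split; first by rewrite sh.
    by move=> v; rewrite hE; case: ifP => // /g0.
  rewrite -g1; have -> : \sum_(v <- s) g v = \sum_(v <- s) h v.
    by rewrite big_seq_cond [RHS]big_seq_cond; apply: eq_bigr => v /andP[vs _]; rewrite hE vs.
  apply: big_fset_incl; first by rewrite sh; exact: fset_sub.
  by move=> v _; rewrite mem_finsupp negbK => /eqP.
by exists (SigSub (mem_set bh)).
Qed.

Lemma realization_normalize s (g : V -> R) : (forall v, v \in s -> 0 <= g v) ->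
  (exists2 v, v \in s & g v != 0) -> K [fset v in s | g v != 0]%fset ->
  exists (w : realization R K) (c : R), 0 < c /\
    forall v, val w v = if v \in s then c * g v else 0.
Proof.
move=> g0 [u us gu0] Kg; pose S := \sum_(v <- s) g v.
have S0 : 0 < S.
  rewrite /S (big_fsetD1 u)//= ltr_pwDl//; first by rewrite lt_neqAle eq_sym gu0 g0.
  by rewrite big_seq_cond; apply: sumr_ge0 => v /andP[]; rewrite !inE => /andP[_ /g0].
have S'0 : S^-1 != 0 by rewrite invr_eq0 gt_eqF.
have [| | |w wE] := @realization_mk s (fun v => S^-1 * g v).
- by move=> v vs; rewrite mulr_ge0 ?g0// invr_ge0 ltW.
- by rewrite -mulr_sumr mulVf// gt_eqF.
- rewrite (_ : [fset v in s | _]%fset = [fset v in s | g v != 0]%fset)//.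
  by apply/fsetP => v; rewrite !inE/= mulf_eq0 (negbTE S'0).
by exists w, S^-1; split=> //; rewrite invr_gt0.
Qed.

Lemma realization_openE (U : set (realization R K)) : open U = realization_open U.
Proof. by []. Qed.

Lemma coords_continuous : continuous (@coords R V K).
Proof. by apply/continuousP => B oB; rewrite realization_openE => s _; exists B. Qed.

Lemma coord_continuous v : continuous (fun w => val w v).
Proof.
move=> w; apply: (@continuous_comp _ _ _ (@coords R V K) (fun c => c v)).
  exact: coords_continuous.
exact: (@proj_continuous V (fun=> R)).
Qed.

Lemma coords_inj : injective (@coords R V K).
Proof. by move=> w w' /(congr1 (fun f => f _)) ww'; apply: realization_inj => v; exact: ww'. Qed.

Lemma ptws_hausdorff : hausdorff_space {ptws V -> R}.
Proof. by apply: hausdorff_product => v; exact: Rhausdorff. Qed.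

Lemma closed_coord0 v : closed [set w : realization R K | val w v = 0].
Proof.
rewrite (_ : mkset _ = (fun w => val w v) @^-1` [set 0]); last by [].
apply: closed_comp; last exact: closed_eq.
by move=> w _; exact: coord_continuous.
Qed.

(** Each trace has a compact, hence closed, image in the Hausdorff space of coordinates; as [coords]
    is injective, the complement of this image witnesses the openness of the complement of Z on that
    simplex. *)
Lemma closed_realization (Z : set (realization R K)) :
  (forall s, K s -> compact (Z `&` @closed_simplex R V K s)) -> closed Z.
Proof.
move=> cZ; rewrite -openC realization_openE => s /cZ cZs.
exists (~` (coords @` (Z `&` @closed_simplex R V K s))).
  apply/closed_openC; apply: compact_closed; first exact: ptws_hausdorff.
  by apply: continuous_image_compact => //; exact: coords_continuous.
apply/seteqP; split=> w [/= nZw ws]; split=> //.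
  by case=> w' [Zw' _] /coords_inj w'w; apply: nZw; rewrite -w'w.
by move=> Zw; apply: nZw; exists w.
Qed.

Hypothesis faceK : face_closed K.

(** In coordinates the simplex on s is a closed part of a compact cube. A cluster point found there
    lifts back, its support being a face of s, and on s the weak topology is the one of the
    coordinates. *)
Lemma compact_simplex s : K s -> compact (@closed_simplex R V K s).
Proof.
move=> Ks F PF Fs.
pose D := [set c : {ptws V -> R} |
  (forall v, [set x : R | if v \in s then `[0, 1]%classic x else x = 0] (c v))].
have cD : compact D.
  apply: (@tychonoff V (fun=> R)
    (fun v => [set x : R | if v \in s then `[0, 1]%classic x else x = 0])) => v.
  by case: (v \in s); [exact: segment_compact|exact: compact_set1].
pose sigma (c : {ptws V -> R}) : R := \sum_(v <- s) c v.
have sigma_cont : continuous sigma.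
  rewrite /sigma; elim: (enum_fset s) => [|v r IH].
    have -> : (fun c : {ptws V -> R} => \sum_(v <- [::]) c v) = fun=> 0.
      by apply/funext => c; rewrite big_nil.
    exact: cst_continuous.
  have -> : (fun c : {ptws V -> R} => \sum_(v <- v :: r) c v) =
            fun c : {ptws V -> R} => c v + \sum_(v <- r) c v.
    by apply/funext => c; rewrite big_cons.
  move=> c; apply: (@continuousD _ _ _ (fun c : {ptws V -> R} => c v)); last exact: IH.
  exact: (@proj_continuous V (fun=> R)).
pose E := D `&` sigma @^-1` [set 1].
have cE : compact E.
  apply: (subclosed_compact _ cD); last by move=> c [].
  apply: closedI; first by apply: compact_closed => //; exact: ptws_hausdorff.
  apply: closed_comp; last exact: closed_eq.
  by move=> c _; exact: sigma_cont.
have FE : F (@coords R V K @^-1` E).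
  apply: filterS Fs => w /= ws; split; last exact: sum_coords ws.
  move=> v /=; case: ifPn => vs; first by rewrite /= in_itv/= coord_ge0 coord_le1.
  apply/eqP; rewrite -[_ == _]negbK -mem_finsupp.
  by apply: contra vs; exact: (fsubsetP ws).
have [c [[Dc sc] clc]] := cE (@coords R V K @ F) _ FE.
have [| | |w wE] := @realization_mk s c.
- by move=> v vs; move: (Dc v) => /=; rewrite vs /= in_itv/= => /andP[].
- exact: sc.
- apply: (faceK Ks); first exact: fset_sub.
  apply/eqP => s0; move: sc; rewrite /sigma/= big_seq_cond big1; last first.
    move=> v; rewrite andbT => vs.
    have : v \notin [fset v in s | c v != 0]%fset by rewrite s0 inE.
    by rewrite !inE/= vs/= negbK => /eqP.
  by move=> /esym/eqP; rewrite oner_eq0.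
have cw : coords w = c.
  apply/funext => v; rewrite /coords wE; case: ifPn => // vs.
  by move: (Dc v) => /=; rewrite (negbTE vs).
have ws : closed_simplex s w.
  apply/fsubsetP => v; rewrite mem_finsupp wE.
  by case: ifP => //; rewrite eqxx.
exists w; split=> // A B FA; rewrite nbhsE => -[U [oU Uw] UB].
have [C oC UC] : exists2 C : set {ptws V -> R}, open C &
    U `&` closed_simplex s = coords @^-1` C `&` closed_simplex s.
  by move: oU; rewrite realization_openE; exact.
have nC : nbhs c C.
  apply: open_nbhs_nbhs; split=> //.
  have : (U `&` closed_simplex s) w by split.
  by rewrite UC => -[]; rewrite /= cw.
have FA' : F (@coords R V K @^-1` (@coords R V K @` (A `&` closed_simplex s))).
  by apply: filterS (filterI FA Fs) => z Az /=; exists z.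
have [_ [[z [Az zs] <-] Cz]] := clc _ C FA' nC.
exists z; split=> //; apply: UB.
have : (coords @^-1` C `&` closed_simplex s) z by split.
by rewrite -UC => -[].
Qed.

(** A need not be a simplex: the set is the union of the closed simplices on the finitely many
    subsets of A that lie in K. *)
Lemma compact_subfaces A : compact (@closed_simplex R V K A).
Proof.
have -> : @closed_simplex R V K A =
    \big[setU/set0]_(s <- enum_fset (fpowerset A) | `[< K s >]) closed_simplex s.
  rewrite -bigcup_seq_cond; apply/seteqP; split=> w /=.
    move=> wA; exists (finsupp (val w)) => /=; last exact: fsubset_refl.
    by rewrite fpowersetE wA/=; apply/asboolP; exact: supp_K.
  move=> [s /= /andP[sA _] ws]; apply: (fsubset_trans ws).
  by move: sA; rewrite fpowersetE.
elim/big_ind: _ => [|B C|s /asboolP Ks]; [exact: compact0|exact: compactU|].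
exact: compact_simplex.
Qed.

End realization_theory.

(** * Quotients |K|/|L|: compact subsets and separation *)

Section relative_realization_theory.
Context {R : realType} {V : choiceType}.
Variables K L : set {fset V}.
Local Notation X := (realization R K).
Local Notation inL := [set w : X | L (finsupp (val w))].
Local Notation pi := (@collapse_pi X inL).

(** As for CW complexes, a compact set meets finitely many open cells: one point is picked in each
    open simplex met off the base point, and the picked points form a closed discrete set. *)
Lemma compact_finite_support (C : set (relative_realization R K L)) :
  compact C -> exists A : {fset V}, forall w : X, ~ inL w -> C (pi w) ->
    (finsupp (val w) `<=` A)%fset.
Proof.
move=> cC.
pose D := [set s : {fset V} | exists w : X, [/\ ~ inL w, C (pi w) & finsupp (val w) = s]].
have [[s0 Ds0]|D0] := pselect (exists s, D s); last first.
  by exists fset0 => w nLw Cw; case: D0; exists (finsupp (val w)), w.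
have [w0 _] := Ds0.
have /choice[g gP] : forall s, exists w : X, D s ->
    [/\ ~ inL w, C (pi w) & finsupp (val w) = s].
  move=> s; have [[w wP]|nDs] := pselect (D s); first by exists w.
  by exists w0.
(* A closed simplex contains at most one picked point for each of its finitely many faces. *)
have closed_reps (E : set {fset V}) : E `<=` D ->
    closed [set pi (g s) | s in E].
  move=> ED; apply/collapse_closedP; apply: closed_realization => s _.
  apply: finite_compact.
  apply: (@sub_finite_set _ _ (g @` [set` fpowerset s])); last first.
    exact/finite_image/finite_fset.
  move=> w [/= [t Et gtw] ws]; have [nLt _ st] := gP _ (ED _ Et).
  have <- : g t = w by apply: collapse_pi_inj gtw.
  by exists t => //=; rewrite fpowersetE -st (collapse_pi_inj nLt gtw).
(* Within the picked points, [f s] contains only the one of s, so a finite subcover has to list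
   every simplex of D. *)
pose f s := ~` [set pi (g t) | t in D `\ s].
have := cC; rewrite compact_cover => /(_ _ D f)[].
- by move=> s _; apply/closed_openC/closed_reps => t [].
- move=> z Cz; have [[t Dt tz]|nz] := pselect (exists2 t, D t & pi (g t) = z).
    exists t => //; rewrite /f/= => -[u [Du ut] uz]; apply: ut.
    have [nLu _ <-] := gP _ Du; have [_ _ <-] := gP _ Dt.
    by congr (finsupp (val _)); apply: (collapse_pi_inj nLu); rewrite uz tz.
  by exists s0 => //; rewrite /f/= => -[t [Dt _] tz]; apply: nz; exists t.
move=> D' _ CD'; exists (\bigcup_(s <- D') s)%fset => w nLw Cw.
have Dw : D (finsupp (val w)) by exists w.
have [nLg Cg gw] := gP _ Dw.
have [s /= sD' fs] := CD' _ Cg.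
have ws : finsupp (val w) = s.
  by apply: contrapT => ws; apply: fs; exists (finsupp (val w)).
by rewrite ws; exact: (bigfcup_sup (P := xpredT)).
Qed.

(** The functions w_v w_a w_b vanish on L, hence descend to the quotient. The one with v = a detects
    the base point; together they determine the other points up to scale, hence completely. *)
Lemma relative_realization_hausdorff (a b : V) :
  (forall s, K s -> L s <-> ~ (a \in s /\ b \in s)) ->
  hausdorff_space (relative_realization R K L).
Proof.
move=> KL.
have inLP w : ~ inL w <-> val w a != 0 /\ val w b != 0.
  by rewrite -!mem_finsupp /mkset (KL _ (supp_K w)) notK; split=> -[].
apply: (@hausdorff_separating _ R); first exact: Rhausdorff.
pose f v (z : relative_realization R K L) : R :=
  if z is Some u then val (val u) v * (val (val u) a * val (val u) b) else 0.
have fE v w : f v (pi w) = val w v * (val w a * val w b).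
  have [Lw|nLw] := pselect (inL w).
    rewrite (_ : pi w = None)/=; last exact/collapse_pi_None.
    have [->|a0] := eqVneq (val w a) 0; first by rewrite mul0r mulr0.
    have [->|b0] := eqVneq (val w b) 0; first by rewrite !mulr0.
    by have := (inLP w).2 (conj a0 b0).
  by rewrite (collapse_pi_Some (mem_set nLw)).
have cf v : continuous (f v).
  apply: collapse_continuousP.
  have -> : f v \o pi = fun w => val w v * (val w a * val w b).
    by apply/funext => w; exact: fE.
  by do 2?[apply: continuous_mulr]; exact: coord_continuous.
move=> p q pq; apply: contrapT => nf.
have fpq v : f v p = f v q by apply: contrapT => ?; apply: nf; exists (f v).
apply: pq; move: fpq.
have [->|[x nLx ->]] := collapse_pi_surj p; have [->|[y nLy ->]] := collapse_pi_surj q => //.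
- have [a0 b0] := (inLP _).1 nLy.
  by move=> /(_ a)/esym/eqP; rewrite fE /= !mulf_eq0 (negbTE a0) (negbTE b0).
- have [a0 b0] := (inLP _).1 nLx.
  by move=> /(_ a)/eqP; rewrite fE /= !mulf_eq0 (negbTE a0) (negbTE b0).
- move=> fxy; congr (pi _).
  have [a0 b0] := (inLP _).1 nLx.
  apply: (@realization_proportional _ _ _ x y (val x a * val x b) (val y a * val y b)).
    by rewrite mulf_neq0.
  by move=> v; rewrite mulrC -fE fxy fE mulrC.
Qed.

End relative_realization_theory.

(** * Wedges and smash products of relative realizations *)

(** A homeomorphism described by its graph [E]: in the applications neither direction has a
    convenient formula on the quotients. *)
Lemma homeomorphic_rel (T U : ptopologicalType) (E : T -> U -> Prop) :
  (forall t, exists u, E t u) -> (forall u, exists t, E t u) ->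
  (forall t u u', E t u -> E t u' -> u = u') ->
  (forall t t' u, E t u -> E t' u -> t = t') ->
  E point point ->
  (forall O : set U, open O -> open [set t | exists2 u, E t u & O u]) ->
  (forall O : set T, open O -> open [set u | exists2 t, E t u & O t]) ->
  homeomorphic T U.
Proof.
move=> /choice[f fE] /choice[g gE] Er El Ept of_ og.
exists f, g; split.
- split; last by apply: Er (fE _) Ept.
  apply/continuousP => O oO; have -> : f @^-1` O = [set t | exists2 u, E t u & O u].
    apply/seteqP; split=> t /=; first by exists (f t).
    by case=> u Etu; rewrite (Er _ _ _ (fE t) Etu).
  exact: of_.
- split; last by apply: El (gE _) Ept.
  apply/continuousP => O oO; have -> : g @^-1` O = [set u | exists2 t, E t u & O t].
    apply/seteqP; split=> u /=; first by exists (g u).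
    by case=> t Etu; rewrite (El _ _ _ (gE u) Etu).
  exact: og.
- by move=> t; exact: El (gE _) (fE _).
- by move=> u; exact: Er (fE _) (gE _).
Qed.

Lemma homeomorphic_rel_closed (T U : ptopologicalType) (E : T -> U -> Prop) :
  (forall t, exists u, E t u) -> (forall u, exists t, E t u) ->
  (forall t u u', E t u -> E t u' -> u = u') ->
  (forall t t' u, E t u -> E t' u -> t = t') ->
  E point point ->
  (forall C : set U, closed C -> closed [set t | exists2 u, E t u & C u]) ->
  (forall C : set T, closed C -> closed [set u | exists2 t, E t u & C t]) ->
  homeomorphic T U.
Proof.
move=> E1 E2 Er El Ept cf cg; apply: (homeomorphic_rel E1 E2 Er El Ept) => O oO.
- have -> : [set t | exists2 u, E t u & O u] = ~` [set t | exists2 u, E t u & (~` O) u].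
    apply/seteqP; split=> t /=; first by case=> u Eu Ou [u' Eu']; rewrite (Er _ _ _ Eu' Eu).
    by have [u Eu] := E1 t; move=> nO; exists u => //; apply: contrapT => nOu; apply: nO; exists u.
  exact/closed_openC/cf/open_closedC.
- have -> : [set u | exists2 t, E t u & O t] = ~` [set u | exists2 t, E t u & (~` O) t].
    apply/seteqP; split=> u /=; first by case=> t Et Ot [t' Et']; rewrite (El _ _ _ Et' Et).
    by have [t Et] := E2 u; move=> nO; exists t => //; apply: contrapT => nOu; apply: nO; exists t.
  exact/closed_openC/cg/open_closedC.
Qed.

Lemma realization_transfer (R : realType) (V : choiceType) (K K' : set {fset V})
    (w' : realization R K') : K (finsupp (val w')) ->
  exists w : realization R K, val w = val w'.
Proof.
move=> Kw; have bw : barycentric K (val w').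
  by have [_ ? ?] := set_mem (valP w'); split.
by exists (SigSub (mem_set bw)).
Qed.

Section wedge.
Context {R : realType} {V : choiceType} {I : choiceType}.
Variables (K L : set {fset V}) (S : I -> set {fset V}).
Hypotheses (LK : L `<=` K) (SK : forall i, S i `<=` K)
  (SL : forall i s, S i s -> ~ L s)
  (S_inj : forall i j s, S i s -> S j s -> i = j)
  (KSL : forall s, K s -> L s \/ exists i, S i s)
  (faceL : forall s t, L s -> K t -> (t `<=` s)%fset -> L t)
  (faceS : forall i s t, S i s -> K t -> (t `<=` s)%fset -> S i t \/ L t).

Let T i := relative_realization R (S i `|` L) L.
Let pi := @collapse_pi (realization R K) [set w | L (finsupp (val w))].
Let pi_ i := @collapse_pi (realization R (S i `|` L)) [set w | L (finsupp (val w))].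
Let pi' := @collapse_pi {i : I & T i} [set x : {i : I & T i} | projT2 x = point].

(** Besides the base points, points correspond when they have the same barycentric coordinates, in
    an open simplex of one class. *)
Let E (z : relative_realization R K L) (r : wedge_sum T) : Prop :=
  (z = None /\ r = None) \/
  exists i (w : realization R K) (w' : realization R (S i `|` L)),
    [/\ S i (finsupp (val w)), val w = val w', z = pi w &
        r = pi' (existT _ i (pi_ w'))].

Let pi'_None i (w' : realization R (S i `|` L)) :
  pi' (existT _ i (pi_ w')) = None <-> L (finsupp (val w')).
Proof.
rewrite /pi' collapse_pi_None/=.
exact: (@collapse_pi_None (realization R (S i `|` L)) [set w | L (finsupp (val w))] w').
Qed.

Let pi_None (w : realization R K) : pi w = None <-> L (finsupp (val w)).
Proof. exact: (@collapse_pi_None _ [set w : realization R K | L (finsupp (val w))] w). Qed.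

Let E_intro i (w : realization R K) (w' : realization R (S i `|` L)) :
  val w = val w' -> E (pi w) (pi' (existT _ i (pi_ w'))).
Proof.
move=> ww'; have [Si|Lw] := supp_K w'; last first.
  by left; split; [apply/pi_None; rewrite ww'|exact/pi'_None].
by right; exists i, w, w'; split=> //; rewrite ww'.
Qed.

Let E_right z r r' : E z r -> E z r' -> r = r'.
Proof.
case=> [[-> ->]|[i [w [w' [Si ww' -> ->]]]]]; case=> [[+ ->]|[j [u [u' [Sj uu' + ->]]]]] => //.
- by move=> /esym/pi_None/(SL Sj).
- by move=> /pi_None/(SL Si).
- move=> /collapse_pi_inj wu; have {}wu := wu (SL Si).
  subst u; have ij := S_inj Si Sj; subst j; congr (pi' (existT _ i (pi_ _))).
  by apply: val_inj; rewrite -ww'.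
Qed.

Let E_left z z' r : E z r -> E z' r -> z = z'.
Proof.
case=> [[-> ->]|[i [w [w' [Si ww' -> ->]]]]]; case=> [[-> +]|[j [u [u' [Sj uu' -> +]]]]] => //.
- by move=> /esym/pi'_None; rewrite -uu' => /(SL Sj).
- by move=> /pi'_None; rewrite -ww' => /(SL Si).
- move=> /collapse_pi_inj eE.
  have {}eE : existT (fun i => T i : Type) i (pi_ w') = existT _ j (pi_ u').
    by apply: eE => /(collapse_pi_None _).1/=; rewrite -ww'; exact: SL Si.
  have ij := congr1 (@projT1 _ _) eE; rewrite /= in ij; subst j.
  have /collapse_pi_inj wu := eq_from_Tagged eE.
  congr (pi _); apply: val_inj; rewrite ww' uu' wu//= -ww'.
  exact: SL Si.
Qed.

(** A closed simplex of class i has all its faces in [S i] or L, so openness is tested on one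
    summand at a time, where both sides have the same coordinates. *)
Lemma wedge_homeomorphic :
  homeomorphic (relative_realization R K L) (wedge_sum T).
Proof.
apply: (@homeomorphic_rel _ _ E _ _ E_right E_left).
- move=> z; have [->|[w nLw ->]] := collapse_pi_surj z; first by exists None; left.
  have [//|[i Si]] := KSL (supp_K w).
  have [w' w'w] : exists w' : realization R (S i `|` L), val w' = val w.
    by apply: realization_transfer; left.
  by exists (pi' (existT _ i (pi_ w'))); exact: E_intro.
- move=> r; have [->|[[i t] /= nt ->]] := collapse_pi_surj r; first by exists None; left.
  have [t0|[w' nLw' tw']] := collapse_pi_surj t; first by rewrite t0 in nt.
  have [w ww'] : exists w : realization R K, val w = val w'.
    by apply: realization_transfer; case: (supp_K w') => [/SK|/LK].
  by exists (pi w); rewrite tw'; exact: E_intro.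
- by left.
- move=> O oO; change (open [set w | exists2 r, E (pi w) r & O r]).
  rewrite realization_openE => s /[dup] Ks /KSL[Ls|[i Si]].
    (* All of this closed simplex goes to the base point, so the trace is everything or nothing. *)
    have EN w : closed_simplex s w -> pi w = None.
      by move=> ws; apply/pi_None; exact: faceL Ls (supp_K _) ws.
    have [ON|nON] := pselect (O None).
      exists setT; first exact: openT.
      apply/seteqP; split=> w [_ ws]; split=> //.
      by exists None => //; rewrite EN//; left.
    exists set0; first exact: open0.
    apply/seteqP; split=> w; last by case.
    case=> -[r Er Or] ws; case: nON; move: Or; rewrite (EN _ ws) in Er.
    by rewrite (E_right Er (or_introl (conj erefl erefl))).
  have oOi : open [set w' : realization R (S i `|` L) | O (pi' (existT _ i (pi_ w')))].
    have : open (pi' @^-1` O) by [].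
    by move=> /sigT_openP/(_ i).
  have [B oB OB] : exists2 B : set {ptws V -> R}, open B & _ := oOi s (or_introl Si).
  exists B => //; apply/seteqP; split=> w [+ ws].
    move=> [r Er Or].
    have [w' w'w] : exists w' : realization R (S i `|` L), val w' = val w.
      by apply: realization_transfer; exact: faceS Si (supp_K w) ws.
    have : ([set w' | O (pi' (existT _ i (pi_ w')))] `&` closed_simplex s) w'.
      split; first by rewrite /= (E_right (E_intro (esym w'w)) Er).
      by rewrite /closed_simplex/= w'w.
    by rewrite OB => -[]; rewrite /preimage/= /coords w'w.
  move=> Bw.
  have [w' w'w] : exists w' : realization R (S i `|` L), val w' = val w.
    by apply: realization_transfer; exact: faceS Si (supp_K w) ws.
  have : (coords @^-1` B `&` closed_simplex s) w'.
    by split; [rewrite /preimage/= /coords w'w|rewrite /closed_simplex/= w'w].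
  rewrite -OB => -[/= Ow' _]; split=> //.
  by exists (pi' (existT _ i (pi_ w'))) => //; exact: E_intro.
- move=> O oO; suff : open [set x : {i : I & T i} | exists2 t, E t (pi' x) & O t] by [].
  apply/sigT_openP => i.
  suff : open [set w' : realization R (S i `|` L) |
      exists2 t, E t (pi' (existT _ i (pi_ w'))) & O t] by [].
  rewrite realization_openE => s sSL.
  have Ks : K s by case: sSL => [/SK|/LK].
  have oOi : open (pi @^-1` O) by [].
  have [B oB OB] : exists2 B : set {ptws V -> R}, open B & _ := oOi s Ks.
  exists B => //; apply/seteqP; split=> w' [+ ws].
    move=> [t Et Ot].
    have [w ww'] : exists w : realization R K, val w = val w'.
      by apply: realization_transfer; case: (supp_K w') => [/SK|/LK].
    have : (pi @^-1` O `&` closed_simplex s) w.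
      split; first by rewrite /= (E_left (E_intro ww') Et).
      by rewrite /closed_simplex/= ww'.
    by rewrite OB => -[]; rewrite /preimage/= /coords ww'.
  move=> Bw.
  have [w ww'] : exists w : realization R K, val w = val w'.
    by apply: realization_transfer; case: (supp_K w') => [/SK|/LK].
  have : (coords @^-1` B `&` closed_simplex s) w.
    by split; [rewrite /preimage/= /coords ww'|rewrite /closed_simplex/= ww'].
  rewrite -OB => -[/= Ow _]; split=> //.
  by exists (pi w) => //; exact: E_intro.
Qed.

End wedge.

(** * Smash products and the compactly generated topology *)

Lemma kspace_closedP (T : topologicalType) (Z : set (kspace T)) :
  (forall C : set T, compact C -> exists2 D : set T, closed D & D `&` C = (Z : set T) `&` C) ->
  closed Z.
Proof.
move=> h; rewrite -openC; suff : kspace_open (~` Z) by [].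
by move=> C /h CD; rewrite openC; exact/closed_subspaceP.
Qed.

Lemma closed_kspace (T : topologicalType) (Z : set (kspace T)) :
  closed Z -> forall C : set T, compact C ->
  exists2 D : set T, closed D & D `&` C = (Z : set T) `&` C.
Proof.
rewrite -openC => oZ C cC; apply/closed_subspaceP; rewrite -openC.
exact: oZ.
Qed.

Section smash.
Context {R : realType} {V : choiceType} {I : finType}.
Variables (K L : set {fset V}) (K_ L_ : I -> set {fset V}).

Let X := realization R K.
Let X_ i := realization R (K_ i).
Let M_ i : ptopologicalType := relative_realization R (K_ i) (L_ i).
Let inL : set X := [set w | L (finsupp (val w))].
Let inL_ i : set (X_ i) := [set w | L_ i (finsupp (val w))].

(** [Q] is the set of vertices that [Rel] takes into account. Points in the collapsed part may have
    other vertices, so [Rel_base] is asked only for points supported in [Q]. *)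
Variables (Q : set V) (Rel : X -> (forall i, X_ i) -> Prop).
Hypotheses
  (faceK : face_closed K) (faceK_ : forall i, face_closed (K_ i))
  (faceL : forall s t, L s -> K t -> (t `<=` s)%fset -> L t)
  (hausM_ : forall i, hausdorff_space (M_ i))
  (closedL : closed inL)
  (closedRel : closed [set p : X * prod_topology X_ | Rel p.1 p.2])
  (supp_Q : forall s v, K s -> ~ L s -> v \in s -> Q v)
  (Rel_base : forall (y : X) (x : forall i, X_ i),
     (forall v, v \in finsupp (val y) -> Q v) -> Rel y x ->
     (inL y <-> exists i, inL_ (x i)))
  (Rel_right : forall y x x', ~ inL y -> Rel y x -> Rel y x' -> x = x')
  (Rel_left : forall y y' x, ~ inL y -> ~ inL y' -> Rel y x -> Rel y' x -> y = y')
  (Rel_total : forall y, ~ inL y -> exists x, Rel y x)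
  (Rel_surj : forall x, (forall i, ~ inL_ (x i)) -> exists2 y, ~ inL y & Rel y x)
  (supp_right : forall A : {fset V}, exists B : I -> {fset V}, forall y x, ~ inL y ->
     Rel y x -> (finsupp (val y) `<=` A)%fset -> forall i, (finsupp (val (x i)) `<=` B i)%fset)
  (supp_left : forall B : I -> {fset V}, exists A : {fset V}, forall y x, ~ inL y ->
     Rel y x -> (forall i, (finsupp (val (x i)) `<=` B i)%fset) -> (finsupp (val y) `<=` A)%fset).

Let pi := @collapse_pi X inL.
Let pi_ i := @collapse_pi (X_ i) (@inL_ i).
Let q (x : prod_topology X_) : prod_topology M_ := fun i => pi_ (x i).
Let fat : set (prod_topology M_) := [set f | exists i, f i = point].
Let pi' := @collapse_pi (kspace (prod_topology M_)) fat.

Let E (z : relative_realization R K L) (r : smash M_) : Prop :=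
  (z = None /\ r = None) \/
  exists y x, [/\ ~ inL y, Rel y x, z = pi y & r = pi' (q x)].

Let fat_q x : fat (q x) <-> exists i, inL_ (x i).
Proof.
by split=> -[i xi]; exists i; [apply/(collapse_pi_None (A := @inL_ i))|apply/collapse_pi_None].
Qed.

Let Qy y : ~ inL y -> forall v, v \in finsupp (val y) -> Q v.
Proof. by move=> nLy v; exact: supp_Q (supp_K y) nLy. Qed.

Let nfat y x : ~ inL y -> Rel y x -> ~ fat (q x).
Proof. by move=> nLy yx; rewrite fat_q -(Rel_base (Qy nLy) yx). Qed.

Let E_intro y x : (forall v, v \in finsupp (val y) -> Q v) -> Rel y x ->
  E (pi y) (pi' (q x)).
Proof.
move=> yQ yx; have [Ly|nLy] := pselect (inL y); last by right; exists y, x.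
left; split; first exact/collapse_pi_None.
by apply/collapse_pi_None/fat_q/(Rel_base yQ yx).
Qed.

Let pi_q_inj x x' : ~ fat (q x) -> q x = q x' -> x = x'.
Proof.
move=> nx xx'; apply: functional_extensionality_dep => i.
apply: (@collapse_pi_inj _ (@inL_ i)); last exact: (congr1 (fun f => f i) xx').
by move=> xi; apply: nx; apply/fat_q; exists i.
Qed.

Let q_surj g : ~ fat g -> exists2 x : prod_topology X_, (forall i, ~ inL_ (x i)) & q x = g.
Proof.
move=> nfg; have xP i : {x : X_ i | ~ inL_ x /\ g i = pi_ x}.
  apply: cid; have [gi|[x nLx gx]] := collapse_pi_surj (g i); last by exists x.
  by case: nfg; exists i.
exists (fun i => sval (xP i)) => [i|]; first by case: (xP i) => x [].
by apply: functional_extensionality_dep => i; rewrite /q; case: (xP i) => x [].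
Qed.

Let E_right z r r' : E z r -> E z r' -> r = r'.
Proof.
case=> [[-> ->]|[y [x [nLy yx -> ->]]]]; case=> [[+ ->]|[y' [x' [nLy' yx' + ->]]]] => //.
- by move=> /esym/(collapse_pi_None _).1.
- by move=> /(collapse_pi_None _).1.
- move=> /(collapse_pi_inj nLy) yy'; subst y'.
  by rewrite (Rel_right nLy yx yx').
Qed.

Let E_left z z' r : E z r -> E z' r -> z = z'.
Proof.
case=> [[-> ->]|[y [x [nLy yx -> ->]]]]; case=> [[-> +]|[y' [x' [nLy' yx' -> +]]]] => //.
- by move=> /esym/(collapse_pi_None _).1/(nfat nLy' yx').
- by move=> /(collapse_pi_None _).1/(nfat nLy yx).
- move=> /(collapse_pi_inj (nfat nLy yx))/(pi_q_inj (nfat nLy yx)) xx'.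
  by subst x'; rewrite (Rel_left nLy nLy' yx yx').
Qed.

Let q_continuous : continuous q.
Proof. by apply: prod_map_continuous => i; exact: collapse_pi_continuous. Qed.

Let box (B : I -> {fset V}) : set (prod_topology X_) :=
  [set x | forall i, closed_simplex (B i) (x i)].

Let compact_box B : compact (box B).
Proof.
apply: (@tychonoff I X_ (fun i => closed_simplex (B i))) => i.
exact/compact_subfaces/faceK_.
Qed.

Let hausdorff_prod : hausdorff_space (prod_topology M_).
Proof. exact: (@hausdorff_product I M_). Qed.

(** The graph of [Rel] is closed, so its part over a closed simplex and a box is compact. Both
    closedness proofs below project such a part to one side. *)
Let compact_rel (C : set X) (D : set (prod_topology M_)) A B : closed C -> closed D ->
  compact [set p : X * prod_topology X_ |
    [/\ Rel p.1 p.2, C p.1, closed_simplex A p.1, D (q p.2) & box B p.2]].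
Proof.
move=> cC cD; have -> : [set p : X * prod_topology X_ |
    [/\ Rel p.1 p.2, C p.1, closed_simplex A p.1, D (q p.2) & box B p.2]] =
    [set p : X * prod_topology X_ | Rel p.1 p.2] `&` (fst @^-1` C `&` (snd @^-1` (q @^-1` D)))
      `&` (closed_simplex A `*` box B).
  by apply/seteqP; split=> -[y x] /=; [case|case=> -[? [? ?]] []].
rewrite setIC; apply: compact_closedI.
  by apply: compact_setX => //; exact/compact_subfaces/faceK.
apply: closedI => //; apply: closedI.
  by apply: closed_comp => // p _; exact: cvg_fst.
apply: closed_comp; first by move=> p _; exact: cvg_snd.
by apply: closed_comp => // x _; exact: q_continuous.
Qed.

(** Tested on a closed simplex s. The partners of its points lie in one box, whose image under [q]
    is compact; on that image, C is the trace of a set D closed in the product topology, to which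
    [compact_rel] applies. *)
Let image_closed (C : set (smash M_)) : closed C ->
  closed [set z | exists2 r, E z r & C r].
Proof.
move=> cC; apply/collapse_closedP; apply: closed_realization => s Ks.
have cs : compact (@closed_simplex R V K s) by exact: compact_simplex.
have [Ls|nLs] := pselect (L s).
  have EN y : closed_simplex s y -> pi y = None.
    by move=> ys; apply/collapse_pi_None; exact: faceL Ls (supp_K _) ys.
  have [CN|nCN] := pselect (C None).
    rewrite setIidr// => y ys; exists None => //=.
    by left; split => //; exact: EN.
  rewrite (_ : _ `&` _ = set0); first exact: compact0.
  apply/seteqP; split=> y; last by case.
  case=> -[r Er Cr] ys; apply: nCN; move: Cr; rewrite -/pi (EN _ ys) in Er.
  by rewrite (E_right Er (or_introl (conj erefl erefl))).
have [B AB] := supp_right s.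
have cpC : closed (pi' @^-1` C) by exact/collapse_closedP.
have [D cD DC] := closed_kspace cpC
  (continuous_image_compact q_continuous (@compact_box B)).
have DCq x : box B x -> D (q x) <-> C (pi' (q x)).
  move=> Bx; have qB : (q @` box B) (q x) by exists x.
  have e : (D `&` q @` box B) (q x) = ((pi' @^-1` C) `&` q @` box B) (q x) by rewrite DC.
  split=> h; first by have [] : ((pi' @^-1` C) `&` q @` box B) (q x) by rewrite -e.
  by have [] : (D `&` q @` box B) (q x) by rewrite e.
(* Points of s over the base point are collected apart, since [Rel] need not give them a partner. *)
pose Y := [set y | [/\ C None, inL y & closed_simplex s y]].
rewrite (_ : _ `&` _ = Y `|` fst @` [set p : X * prod_topology X_ |
    [/\ Rel p.1 p.2, setT p.1, closed_simplex s p.1, D (q p.2) & box B p.2]]); last first.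
  apply/seteqP; split=> y.
    case=> -[r Er Cr] ys; rewrite -/pi in Er; have [Ly|nLy] := pselect (inL y).
      left; split=> //; have piy : pi y = None by apply/collapse_pi_None.
      by move: Cr; rewrite piy in Er; rewrite (E_right Er (or_introl (conj erefl erefl))).
    have [x yx] := Rel_total nLy; right; exists (y, x) => //=.
    have Bx : box B x by move=> i; exact: (AB y).
    split=> //; apply/DCq => //; rewrite (E_right (E_intro _ yx) Er)//; exact: Qy.
  case=> [[CN Ly ys]|[[y' x] /= [yx _ ys Dx Bx] <-]]; split=> //.
    by exists None => //; left; split=> //; exact/collapse_pi_None.
  exists (pi' (q x)); last exact/DCq.
  by apply: E_intro => // v /(fsubsetP ys); exact: supp_Q.
apply: compactU; last first.
  apply: continuous_image_compact; first by move=> p; exact: cvg_fst.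
  by apply: compact_rel => //; exact: closedT.
have [CN|nCN] := pselect (C None).
  rewrite (_ : Y = inL `&` closed_simplex s); last first.
    by apply/seteqP; split=> y; [case|case=> ? ?; split].
  by rewrite setIC; exact: compact_closedI.
rewrite (_ : Y = set0); first exact: compact0.
by apply/seteqP; split=> y; [case|].
Qed.

(** Tested on a compact set G of the product. Its projections are compact, so off the base points
    their supports stay in finite sets [B i], and the partners in |K| have their supports in one
    finite set. *)
Let preimage_closed (C : set (relative_realization R K L)) : closed C ->
  closed [set r | exists2 z, E z r & C z].
Proof.
move=> cC; apply/collapse_closedP; apply: kspace_closedP => G cG.
have /choice[B BP] : forall i, exists B : {fset V}, forall x : X_ i, ~ inL_ x ->
    ((fun f : prod_topology M_ => f i) @` G) (pi_ x) -> (finsupp (val x) `<=` B)%fset.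
  move=> i; apply: compact_finite_support.
  by apply: continuous_image_compact => //; exact: (@proj_continuous I M_).
have [A0 A0P] := supp_left B.
(* The closed simplex on A also contains points of the collapsed part; restricting A to [Q] makes
   [E_intro] applicable to them. *)
pose A := [fset v in A0 | `[< Q v >]]%fset.
have AQ v : v \in A -> Q v by rewrite !inE => /andP[_ /asboolP].
have AP y x : ~ inL y -> Rel y x -> box B x -> closed_simplex A y.
  move=> nLy yx Bx; apply/fsubsetP => v vy; rewrite !inE/=; apply/andP; split.
    by apply: (fsubsetP (A0P y x nLy yx Bx)).
  by apply/asboolP; exact: Qy vy.
have cpC : closed (pi @^-1` C) by exact/collapse_closedP.
pose F := [set g | C None /\ fat g].
exists (F `|` (q \o snd) @` [set p : X * prod_topology X_ |
    [/\ Rel p.1 p.2, (pi @^-1` C) p.1, closed_simplex A p.1, setT (q p.2) & box B p.2]]).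
  apply: closedU.
    have [CN|nCN] := pselect (C None); last first.
      rewrite (_ : F = set0); first exact: closed0.
      by apply/seteqP; split=> y; [case|].
    rewrite (_ : F = \bigcup_(i in [set: I]) [set g | g i = point]); last first.
      by apply/seteqP; split=> g; [case=> _ [i gi]; exists i|case=> i _ gi; split=> //; exists i].
    apply: closed_bigcup => [|i _]; first exact: finite_finset.
    rewrite (_ : mkset _ = (fun f : prod_topology M_ => f i) @^-1` [set point])//.
    apply: closed_comp; first by move=> g _; exact: (@proj_continuous I M_).
    exact/accessible_closed_set1/hausdorff_accessible.
  apply: compact_closed => //; apply: continuous_image_compact.
    move=> p; apply: (@continuous_comp _ _ _ snd q); first exact: cvg_snd.
    exact: q_continuous.
  by apply: compact_rel => //; exact: closedT.
apply/seteqP; split=> g [gP Gg]; split=> //; move: gP.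
  case=> [[CN fg]|[[y x] /= [yx Cy yA _ Bx] <-]].
    exists None => //; left; split=> //; exact/collapse_pi_None.
  exists (pi y) => //; apply: E_intro => // v /(fsubsetP yA); exact: AQ.
case=> z Ez Cz; have [fg|nfg] := pselect (fat g).
  left; split=> //; move: Cz.
  have pig : pi' g = None by exact/collapse_pi_None.
  by rewrite -/pi' pig in Ez; rewrite (E_left Ez (or_introl (conj erefl erefl))).
right; have [x nLx gx] := q_surj nfg.
have [y nLy yx] := Rel_surj nLx.
have Bx : box B x.
  by move=> i; apply: BP => //; exists g => //; rewrite -gx.
exists (y, x) => //=; split=> //; last exact: AP yx Bx.
rewrite /preimage/= (E_left (E_intro (Qy nLy) yx) (_ : E z _))// gx; exact: Ez.
Qed.

Lemma smash_homeomorphic : homeomorphic (relative_realization R K L) (smash M_).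
Proof.
apply: (@homeomorphic_rel_closed _ _ E _ _ E_right E_left).
- move=> z; have [->|[y nLy ->]] := collapse_pi_surj z; first by exists None; left.
  have [x yx] := Rel_total nLy.
  by exists (pi' (q x)); right; exists y, x.
- move=> r; have [->|[g nfg ->]] := collapse_pi_surj r; first by exists None; left.
  have [x nLx gx] := q_surj nfg.
  have [y nLy yx] := Rel_surj nLx.
  by exists (pi y); right; exists y, x; split=> //; rewrite gx.
- by left.
- exact: image_closed.
- exact: preimage_closed.
Qed.

End smash.

(** * Cutting and gluing barycentric coordinates *)

Lemma continuous_subr (R : realType) (T : topologicalType) (f g : T -> R) :
  continuous f -> continuous g -> continuous (fun x => f x - g x).
Proof. by move=> cf cg x; apply: cvgB; [exact: cf|exact: cg]. Qed.

Lemma closed_equalizer (R : realType) (T : topologicalType) (f g : T -> R) :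
  continuous f -> continuous g -> closed [set x | f x = g x].
Proof.
move=> cf cg; have -> : [set x | f x = g x] = (fun x => f x - g x) @^-1` [set 0].
  by apply/seteqP; split=> x /= => [->|/eqP]; rewrite ?subrr// subr_eq0 => /eqP.
by apply: closed_comp; [move=> x _; exact: continuous_subr|exact: closed_eq].
Qed.

Section glue.
Context {R : realType} {V : choiceType} {m : nat}.
Variables (K L : set {fset V}) (K_ L_ : 'I_m -> set {fset V}).
(** [e i], with inverse [d i], puts the i-th piece in its place; [P i] is the interval of that
    piece, with ends [al i] and [be i]; the [A j] are the cut points. *)
Variables (e d : 'I_m -> V -> V) (P : 'I_m -> set V) (A : nat -> V) (al be : 'I_m -> V).

Let X := realization R K.
Let X_ i := realization R (K_ i).
Let inL : set X := [set w | L (finsupp (val w))].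
Let inL_ i : set (X_ i) := [set w | L_ i (finsupp (val w))].

Hypotheses
  (m_gt0 : (0 < m)%N) (eK : forall i, cancel (e i) (d i)) (dK : forall i, cancel (d i) (e i))
  (Pal : forall i, P i (al i)) (Pbe : forall i, P i (be i))
  (e_al : forall i, e i (al i) = A i) (e_be : forall i, e i (be i) = A i.+1)
  (faceK : face_closed K) (faceK_ : forall i, face_closed (K_ i))
  (faceL : forall s t, L s -> K t -> (t `<=` s)%fset -> L t)
  (K_P : forall i s v, K_ i s -> v \in s -> P i v)
  (L_P : forall i s, K_ i s -> L_ i s <-> ~ (al i \in s /\ be i \in s))
  (LP : forall s, K s -> L s <-> exists2 j, (j <= m)%N & A j \notin s)
  (KP : forall s v, K s -> ~ L s -> v \in s -> exists i u, P i u /\ v = e i u)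
  (K_preim : forall s i (t : {fset V}), K s -> ~ L s -> t != fset0 ->
     (forall u, u \in t -> P i u /\ e i u \in s) -> K_ i t)
  (K_glue : forall t : 'I_m -> {fset V}, (forall i, K_ i (t i) /\ ~ L_ i (t i)) ->
     forall s : {fset V}, (forall v, v \in s <-> exists i u, u \in t i /\ v = e i u) -> K s)
  (overlap : forall (i j : 'I_m) u v, (i < j)%N -> P i u -> P j v -> e i u = e j v ->
     [/\ u = be i, v = al j & j = i.+1 :> nat]).

Let Q := [set v | exists i u, P i u /\ v = e i u].

(** Proportionality on each interval, by cross products: this is a closed condition, meaningful also
    where y vanishes. *)
Let Rel (y : X) (x : forall i, X_ i) := forall i u v, P i u -> P i v ->
  val y (e i u) * val (x i) v = val y (e i v) * val (x i) u.

Let neq0 (S : set {fset V}) (w : realization R S) v : (val w v != 0) = (v \in finsupp (val w)).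
Proof. by rewrite mem_finsupp. Qed.

Let inLP y : ~ inL y <-> forall j, (j <= m)%N -> val y (A j) != 0.
Proof.
rewrite /inL /mkset (LP (supp_K y)); split=> [nA j jm|yA [j /yA]].
  by rewrite neq0; apply: contrapT => /negP nj; apply: nA; exists j.
by rewrite neq0 => ->.
Qed.

Let inL_P i (x : X_ i) : ~ inL_ x <-> val x (al i) != 0 /\ val x (be i) != 0.
Proof. by rewrite /inL_ /mkset (L_P (supp_K x)) notK !neq0; split=> -[]. Qed.

Let out i (x : X_ i) v : ~ P i v -> val x v = 0.
Proof.
move=> nP; apply/eqP; rewrite -[_ == _]negbK neq0; apply/negP => vx.
by apply: nP; exact: K_P (supp_K x) vx.
Qed.

Let rel_al y x i v : Rel y x -> P i v ->
  val y (A i) * val (x i) v = val y (e i v) * val (x i) (al i).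
Proof. by move=> yx Pv; rewrite -e_al; exact: yx. Qed.

Let rel_be y x i v : Rel y x -> P i v ->
  val y (A i.+1) * val (x i) v = val y (e i v) * val (x i) (be i).
Proof. by move=> yx Pv; rewrite -e_be; exact: yx. Qed.

(** Some coordinate of x_i is nonzero; comparing it with each end, where y does not vanish, shows
    that x_i is nonzero at both ends. *)
Let rel_nL_ y x : ~ inL y -> Rel y x -> forall i, ~ inL_ (x i).
Proof.
move=> /inLP yA yx i; apply/inL_P; have [v vx] := supp_exists (x i).
have Pv := K_P (supp_K (x i)) vx.
have lt_im := ltn_ord i.
have := mulf_neq0 (yA i (ltnW lt_im)) (_ : val (x i) v != 0).
have := mulf_neq0 (yA i.+1 lt_im) (_ : val (x i) v != 0).
rewrite neq0 (rel_al yx Pv) (rel_be yx Pv) => /(_ vx) + /(_ vx).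
by rewrite !mulf_eq0 !negb_or => /andP[_ ->] /andP[_ ->].
Qed.

(** As each x_i is nonzero at both ends, y vanishes at all cut points or at none. Some coordinate of
    y in some interval is nonzero, which excludes the former. *)
Let rel_nL (y : X) (x : forall i, X_ i) : (forall v, v \in finsupp (val y) -> Q v) -> Rel y x ->
  (forall i, ~ inL_ (x i)) -> ~ inL y.
Proof.
move=> yQ yx nLx; apply/inLP.
have step (i : 'I_m) : (val y (A i) != 0) = (val y (A i.+1) != 0).
  have [a0 b0] := (inL_P (x i)).1 (nLx i).
  have /(congr1 (fun r => r != 0)) := rel_al yx (Pbe i).
  by rewrite e_be !mulf_eq0 (negbTE a0) (negbTE b0) !orbF.
have all0 j : (j <= m)%N -> (val y (A j) != 0) = (val y (A 0) != 0).
  by elim: j => // j IH jm; rewrite -(step (Ordinal jm)) IH// ltnW.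
move=> j jm; rewrite all0//.
have [v vy] := supp_exists y; have [i [u [Pu vu]]] := yQ _ vy.
have [a0 _] := (inL_P (x i)).1 (nLx i).
rewrite -(all0 i (ltnW (ltn_ord i))); apply/eqP => yA.
have /esym/eqP := rel_al yx Pu; rewrite yA mul0r mulf_eq0 (negbTE a0) orbF -vu.
by apply/negP; rewrite neq0.
Qed.

Let Rel_base (y : X) (x : forall i, X_ i) : (forall v, v \in finsupp (val y) -> Q v) ->
  Rel y x -> (inL y <-> exists i, inL_ (x i)).
Proof.
move=> yQ yx; split=> [Ly|[i Lx]]; apply: contrapT.
  by move=> nx; apply: (rel_nL yQ yx _ Ly) => i Lx; apply: nx; exists i.
by move=> nLy; exact: (@rel_nL_ _ _ nLy yx i Lx).
Qed.

Let Rel_right y (x x' : forall i, X_ i) : ~ inL y -> Rel y x -> Rel y x' -> x = x'.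
Proof.
move=> nLy yx yx'; apply: functional_extensionality_dep => i.
have [a'0 _] := (inL_P (x' i)).1 (@rel_nL_ _ _ nLy yx' i).
apply: (@realization_proportional _ _ _ _ _ _ (val (x i) (al i)) a'0) => v.
have [Pv|nPv] := pselect (P i v); last by rewrite !(out _ nPv) !mulr0.
have yA : val y (A i) != 0 by apply: (inLP y).1 => //; exact/ltnW.
apply: (mulfI yA); rewrite mulrCA (rel_al yx Pv) [RHS]mulrCA (rel_al yx' Pv).
by rewrite mulrCA [RHS]mulrCA; congr (_ * _); rewrite mulrC.
Qed.

(** The ratio of the values of y at consecutive cut points is read off x_i, and likewise for y'. So
    y and y' are proportional at the cut points, then on each interval. *)
Let Rel_left (y y' : X) x : ~ inL y -> ~ inL y' -> Rel y x -> Rel y' x -> y = y'.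
Proof.
move=> nLy nLy' yx y'x.
have y'0 : val y' (A 0) != 0 by exact: (inLP y').1.
have prop j : (j <= m)%N -> val y' (A 0) * val y (A j) = val y (A 0) * val y' (A j).
  elim: j => [|j IH] jm; first by rewrite mulrC.
  pose i := Ordinal jm; have [a0 _] := (inL_P (x i)).1 (@rel_nL_ _ _ nLy yx i).
  have h (z : X) : Rel z x -> val z (A j.+1) * val (x i) (al i) = val z (A j) * val (x i) (be i).
    by move=> zx; have := rel_al zx (Pbe i); rewrite e_be => ->.
  by apply: (mulIf a0); rewrite -!mulrA !h// !mulrA IH// ltnW.
apply: (@realization_proportional _ _ _ _ _ _ (val y (A 0)) y'0) => v.
have [[i [u [Pu ->]]]|nQ] := pselect (Q v); last first.
  have z0 (z : X) : ~ inL z -> val z v = 0.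
    move=> nLz; apply/eqP; rewrite -[_ == _]negbK neq0; apply/negP => vz.
    by apply: nQ; exact: KP (supp_K z) nLz vz.
  by rewrite !z0// !mulr0.
have [a0 _] := (inL_P (x i)).1 (@rel_nL_ _ _ nLy yx i).
apply: (mulIf a0); rewrite -!mulrA -!rel_al// !mulrA prop//.
exact/ltnW/ltn_ord.
Qed.

(** Each x_i is the restriction of y to the i-th interval, normalized; it is not zero because y is
    nonzero at [A i]. *)
Let Rel_total y : ~ inL y -> exists x, Rel y x.
Proof.
move=> nLy.
suff xP i : {x : X_ i | exists c, forall v, P i v -> val x v = c * val y (e i v)}.
  exists (fun i => sval (xP i)) => i u v Pu Pv; case: (xP i) => x [c xE] /=.
  by rewrite !xE// mulrCA [RHS]mulrCA [X in _ * X]mulrC.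
apply: cid.
have yA : val y (A i) != 0 by apply: (inLP y).1 => //; exact/ltnW.
pose t := [fset v in [fset d i w | w in finsupp (val y)] | `[< P i v >]]%fset.
have tP v : v \in t <-> P i v /\ e i v \in finsupp (val y).
  rewrite !inE/=; split=> [/andP[/imfsetP[w /= wy ->] /asboolP Pv]|[Pv ey]].
    by rewrite dK.
  rewrite asboolT// andbT; apply/imfsetP; exists (e i v) => //=.
  by rewrite eK.
have alt : al i \in t by apply/tP; rewrite e_al -neq0.
have [| | |x [c [c0 xE]]] := @realization_normalize R V (K_ i) t (fun v => val y (e i v)).
- by move=> v _; exact: coord_ge0.
- by exists (al i); rewrite ?e_al.
- apply: (K_preim (supp_K y) nLy).
    by apply/fset0Pn; exists (al i); rewrite inE; apply/andP; split; rewrite /= ?e_al.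
  by move=> u; rewrite inE => /andP[/tP[]].
exists x, c => v Pv; rewrite xE; case: ifPn => // /negP vt.
suff -> : val y (e i v) = 0 by rewrite mulr0.
apply/eqP; rewrite -[_ == _]negbK neq0; apply/negP => ev.
by apply: vt; apply/tP.
Qed.

(** The x_i are rescaled so as to agree at the shared cut points, then glued and normalized. *)
Let Rel_surj (x : forall i, X_ i) : (forall i, ~ inL_ (x i)) -> exists2 y, ~ inL y & Rel y x.
Proof.
move=> nLx.
have a_gt0 i : 0 < val (x i) (al i).
  by rewrite coord_gt0 -neq0; have [] := (inL_P (x i)).1 (nLx i).
have b_gt0 i : 0 < val (x i) (be i).
  by rewrite coord_gt0 -neq0; have [] := (inL_P (x i)).1 (nLx i).
(* [g j] is the value wanted at [A j], starting from 1: it fixes the factor [lam i] at the left end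
   of the i-th interval, and then yields [g i.+1] at the right end. *)
pose g j := \prod_(k < m | (k < j)%N) (val (x k) (be k) / val (x k) (al k)).
have g_gt0 j : 0 < g j by apply: prodr_gt0 => k _; rewrite divr_gt0.
have gS (i : 'I_m) : g i.+1 = g i * (val (x i) (be i) / val (x i) (al i)).
  rewrite /g (bigD1 i)//= mulrC; congr (_ * _); apply: eq_bigl => k.
  by rewrite ltnS andbC -val_eqE -ltn_neqAle.
pose lam (i : 'I_m) := g i / val (x i) (al i).
have lam_gt0 i : 0 < lam i by rewrite divr_gt0.
have lam_al i : lam i * val (x i) (al i) = g i by rewrite divfK// gt_eqF.
have lam_be i : lam i * val (x i) (be i) = g i.+1 by rewrite gS mulrAC mulrA.
have lt_consistent (i j : 'I_m) u w : (i < j)%N -> P i u -> P j w -> e i u = e j w ->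
    lam i * val (x i) u = lam j * val (x j) w.
  by move=> ij Pu Pw /(overlap ij Pu Pw)[-> -> ji]; rewrite lam_al lam_be ji.
(* Distinct intervals meet at most in a shared cut point, where the rescaled coordinates agree; so
   they define one function. *)
have /choice[h hE] v : exists r, forall i u, P i u -> v = e i u -> r = lam i * val (x i) u.
  have [[i [u [Pu ->]]]|nQ] := pselect (Q v); last first.
    by exists 0 => i u Pu vE; case: nQ; exists i, u.
  exists (lam i * val (x i) u) => j w Pw ew.
  have [ij|ji|/val_inj ij] := ltngtP i j; first exact: lt_consistent.
    by apply/esym/lt_consistent.
  by subst j; rewrite (can_inj (eK i) ew).
pose s := (\bigcup_(i <- enum 'I_m) (e i @` finsupp (val (x i))))%fset.
have sP v : v \in s <-> exists i u, u \in finsupp (val (x i)) /\ v = e i u.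
  split=> [/bigfcupP[i _ /imfsetP[u /= ux ->]]|[i [u [ux ->]]]]; first by exists i, u.
  by apply/bigfcupP; exists i; [rewrite mem_enum|apply/imfsetP; exists u].
have Px i u : u \in finsupp (val (x i)) -> P i u by exact: K_P (supp_K (x i)).
have h_gt0 v : v \in s -> 0 < h v.
  by move=> /sP[i [u [ux ->]]]; rewrite (hE _ i u)//; [rewrite mulr_gt0// coord_gt0|exact: Px].
pose i0 := Ordinal m_gt0.
have [| | |y [c [c0 yE]]] := @realization_normalize R V K s h.
- by move=> v /h_gt0/ltW.
- have sA : e i0 (al i0) \in s by apply/sP; exists i0, (al i0); rewrite -coord_gt0.
  by exists (e i0 (al i0)) => //; rewrite gt_eqF// h_gt0.
- have -> : [fset v in s | h v != 0]%fset = s.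
    apply/fsetP => v; rewrite !inE/=; case: (boolP (v \in s)) => //= vs.
    by rewrite gt_eqF// h_gt0.
  by apply: (@K_glue (fun i => finsupp (val (x i)))) => // i; split; [exact: supp_K|exact: nLx].
have yx i u : P i u -> val y (e i u) = c * (lam i * val (x i) u).
  move=> Pu; rewrite yE (hE _ i u)//; case: ifPn => // /negP nes.
  suff -> : val (x i) u = 0 by rewrite !mulr0.
  apply/eqP; rewrite -[_ == _]negbK neq0; apply/negP => ux.
  by apply: nes; apply/sP; exists i, u.
have Ryx : Rel y x.
  by move=> i u v Pu Pv; rewrite !yx//; move: (lam i) => r; rewrite -!mulrA [X in _ * (_ * X)]mulrC.
exists y => //; apply: rel_nL Ryx nLx => v.
rewrite -neq0 yE; case: ifP => [/sP[i [u [ux ->]]] _|]; last by rewrite eqxx.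
by exists i, u; split=> //; exact: Px.
Qed.

Let supp_right (S : {fset V}) : exists B : 'I_m -> {fset V}, forall (y : X) (x : forall i, X_ i),
  ~ inL y -> Rel y x -> (finsupp (val y) `<=` S)%fset ->
  forall i, (finsupp (val (x i)) `<=` B i)%fset.
Proof.
exists (fun i => [fset d i v | v in S]%fset) => y x nLy yx /fsubsetP yS i.
apply/fsubsetP => v vx; have Pv := K_P (supp_K (x i)) vx.
apply/imfsetP; exists (e i v) => /=; last by rewrite eK.
apply: yS; rewrite -neq0.
have := mulf_neq0 ((inLP y).1 nLy i (ltnW (ltn_ord i))) (_ : val (x i) v != 0).
by rewrite (rel_al yx Pv) neq0 => /(_ vx); rewrite mulf_eq0 negb_or => /andP[].
Qed.

Let supp_left (B : 'I_m -> {fset V}) : exists S : {fset V}, forall (y : X) (x : forall i, X_ i),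
  ~ inL y -> Rel y x -> (forall i, (finsupp (val (x i)) `<=` B i)%fset) ->
  (finsupp (val y) `<=` S)%fset.
Proof.
exists (\bigcup_(i <- enum 'I_m) (e i @` B i))%fset => y x nLy yx xB.
apply/fsubsetP => v vy; have [i [u [Pu vE]]] := KP (supp_K y) nLy vy.
apply/bigfcupP; exists i; first by rewrite mem_enum.
apply/imfsetP; exists u => //=; apply: (fsubsetP (xB i)).
have [a0 _] := (inL_P (x i)).1 (@rel_nL_ _ _ nLy yx i).
have := mulf_neq0 (_ : val y (e i u) != 0) a0.
by rewrite -(rel_al yx Pu) -!neq0 -vE neq0 => /(_ vy); rewrite mulf_eq0 negb_or => /andP[].
Qed.

Let closedL : closed inL.
Proof.
have -> : inL = \bigcup_(j in [set j | (j <= m)%N]) [set w : X | val w (A j) = 0].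
  apply/seteqP; split=> y.
    move=> /(LP (supp_K y))[j jm yj]; exists j => //=.
    by apply/eqP; rewrite -[_ == _]negbK neq0.
  move=> [j /= jm yj]; apply/(LP (supp_K y)); exists j => //.
  by rewrite -neq0 yj eqxx.
apply: closed_bigcup => [|j _]; last exact: closed_coord0.
apply: (sub_finite_set _ (finite_II m.+1)) => j /=.
by rewrite /mkset ltnS.
Qed.

Let closedRel : closed [set p : X * prod_topology X_ | Rel p.1 p.2].
Proof.
have -> : [set p : X * prod_topology X_ | Rel p.1 p.2] =
    \bigcap_(t in [set t : 'I_m * V * V | P t.1.1 t.1.2 /\ P t.1.1 t.2])
      [set p : X * prod_topology X_ | val p.1 (e t.1.1 t.1.2) * val (p.2 t.1.1) t.2 =
        val p.1 (e t.1.1 t.2) * val (p.2 t.1.1) t.1.2].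
  apply/seteqP; split=> -[y x] /=; first by move=> yx [[i u] v] [Pu Pv]; exact: yx.
  by move=> yx i u v Pu Pv; exact: (yx (i, u, v)).
apply: closed_bigI => -[[i u] v] _ /=.
have cy w : continuous (fun p : X * prod_topology X_ => val p.1 w).
  move=> p; apply: (@continuous_comp _ _ _ fst (fun y : X => val y w)); first exact: cvg_fst.
  exact: coord_continuous.
have cx w : continuous (fun p : X * prod_topology X_ => val (p.2 i) w).
  move=> p; apply: (@continuous_comp _ _ _ snd (fun x : prod_topology X_ => val (x i) w)).
    exact: cvg_snd.
  apply: (@continuous_comp _ _ _ (fun x : prod_topology X_ => x i) (fun z => val z w)).
    exact: (@proj_continuous _ X_).
  exact: coord_continuous.
by apply: closed_equalizer; exact: continuous_mulr.
Qed.

Lemma glue_homeomorphic : homeomorphic (relative_realization R K L)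
  (smash (fun i => relative_realization R (K_ i) (L_ i))).
Proof.
apply: (@smash_homeomorphic R V _ K L K_ L_ Q Rel) => //.
- by move=> i; exact: (relative_realization_hausdorff (@L_P i)).
Qed.

End glue.

(** * Frames *)

Section frames.
Context {R : realType} {X : metricType R}.
Implicit Types (x y z w p : X) (s f : seq X) (t l : R).

Lemma len_nil x : len x [::] = 0.
Proof. by rewrite /len big_nil. Qed.

Lemma len_cons x y s : len x (y :: s) = mdist x y + len y s.
Proof. by rewrite /len /= big_cons. Qed.

Lemma len_cat x s1 s2 : len x (s1 ++ s2) = len x s1 + len (last x s1) s2.
Proof. by elim: s1 x => [|y s1 IH] x /=; rewrite ?len_nil ?add0r// !len_cons IH addrA. Qed.

Lemma len_ge0 x s : 0 <= len x s.
Proof. by elim: s x => [|y s IH] x; rewrite ?len_nil// len_cons addr_ge0// mdist_ge0. Qed.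

Lemma len2 x y z : len x [:: y; z] = mdist x y + mdist y z.
Proof. by rewrite !len_cons len_nil addr0. Qed.

(** Repeated triangle inequality. The extra leg to the end of s allows s' to stop early, as the
    induction requires. *)
Lemma len_subseq x s' s : subseq s' s ->
  len x s' + mdist (last x s') (last x s) <= len x s.
Proof.
elim: s x s' => [|y s IH] x s' /=; first by move=> /eqP ->; rewrite len_nil mdistxx addr0.
case: s' => [_|z s'] /=.
  have := IH y [::] (sub0seq _); rewrite /= !len_nil len_cons.
  have := metric_triangle x y (last y s); lra.
case: eqVneq => [-> /(IH y)|_ /(IH y)/=]; rewrite !len_cons; first lra.
have := metric_triangle x y z; lra.
Qed.

Lemma mdist_le_len x s : mdist x (last x s) <= len x s.
Proof. by have := len_subseq x (sub0seq s); rewrite len_nil add0r. Qed.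

(** Going straight to z is already no shorter than s', so omitting y saves nothing and the triangle
    inequality at y is an equality. *)
Lemma geodesic_skip x y s s' : subseq s' s -> s' != [::] ->
  last x s' = last y s -> len x s' = len x (y :: s) ->
  exists z s3, [/\ s = z :: s3, len x [:: y; z] = mdist x z & len x s' = len x s].
Proof.
case: s => [/eqP -> //|z s3] ss' s'0 ls' l'; exists z, s3.
have := len_subseq x ss'; rewrite ls' /= mdistxx addr0 l' !len_cons len_nil addr0.
have := metric_triangle x y z => h1 h2.
by split=> //; lra.
Qed.

(** The frame without its first point ([frameE]), by recursion on the list instead of by
    positions. *)
Fixpoint singular_points x s : seq X :=
  if s is y :: s' then
    let r := singular_points y s' in
    if s' is z :: _ then
      if len x [:: y; z] == mdist x z then r else y :: r
    else [:: y]
  else [::].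

Lemma singular_points_cons2 x y z s : singular_points x (y :: z :: s) =
  if len x [:: y; z] == mdist x z then singular_points y (z :: s)
  else y :: singular_points y (z :: s).
Proof. by []. Qed.

Lemma smooth_cons x y s k : (0 < k)%N -> (k <= size s)%N ->
  smooth x (y :: s) k.+1 = smooth y s k.
Proof.
move=> k0 ks; rewrite /smooth /= k0 ltnS /=; case: (ltnP k (size s)) => //= ks'.
case: k k0 ks ks' => // k _ ks ks' /=.
by rewrite !(@set_nth_default _ _ y x)// ltnW.
Qed.

Lemma frameE x s : frame x s = x :: singular_points x s.
Proof.
rewrite /frame /=; congr (_ :: _).
elim: s x => // y s IH x; rewrite [LHS]/= -[iota 2 _]/(iota (1 + 1) _) iotaDl.
have -> : [seq k <- [seq (1 + i)%N | i <- iota 1 (size s)] | ~~ smooth x (y :: s) k] =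
    [seq (1 + i)%N | i <- iota 1 (size s) & ~~ smooth y s i].
  rewrite filter_map; congr map; apply: eq_in_filter => k.
  by rewrite mem_iota add1n => /andP[k0 ks] /=; rewrite smooth_cons.
have e : [seq nth x (x :: y :: s) k | k <-
    [seq (1 + i)%N | i <- iota 1 (size s) & ~~ smooth y s i]] =
    singular_points y s.
  rewrite -IH -map_comp; apply/eq_in_map => k.
  rewrite mem_filter mem_iota add1n => /andP[_ /andP[_ ks]] /=.
  by rewrite (set_nth_default y).
case: s IH e => [//|z s] IH e; rewrite /smooth /= len2.
by case: eqP => _ /=; rewrite e.
Qed.

Lemma singular_points_subseq x s : subseq (singular_points x s) s.
Proof.
elim: s x => // y s IH x /=; case: s IH => [|z s] IH; first by rewrite eqxx.
by case: ifP => _; [exact: subseq_trans (IH y) (subseq_cons _ _)|rewrite /= eqxx; exact: IH].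
Qed.

Lemma last_singular_points x s : last x (singular_points x s) = last x s.
Proof.
elim: s x => // y [//|z s] IH x.
rewrite [singular_points _ _]/=; case: ifP => _; last exact: (IH y).
have -> : last x (y :: z :: s) = last y (z :: s) by [].
rewrite -(IH y) /=; case: s {IH} => //= w s.
case: ifP => // _; elim: s w z => //= v s IH w z.
by case: ifP => // _; exact: IH.
Qed.

Lemma singular_sequenceP x f :
  singular_sequence x f <-> is_sequence x f /\ singular_points x f = f.
Proof.
have nthE : [seq nth x (x :: f) k | k <- iota 0 (size f).+1] = x :: f.
  by rewrite -/(mkseq _ _) mkseq_nth.
have fE := frameE x f; rewrite /frame in fE.
split=> -[sf h]; split=> //.
  apply: (@proj2 (x = x)); have [//] : (x :: singular_points x f) = x :: f.
    rewrite -fE -[RHS]nthE; congr map; apply/all_filterP/allP => k.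
    by rewrite mem_iota => /andP[_]; rewrite ltnS; exact: h.
move=> k kf; move: fE; rewrite h -nthE => /(congr1 size); rewrite !size_map size_filter.
move=> /eqP; rewrite -all_count => /allP/(_ k); apply.
by rewrite mem_iota.
Qed.

Definition below_four_cuts l : Prop := (l%:E < four_cut_inf X)%E.

Lemma below_four_cutsW l l' : l' <= l -> below_four_cuts l -> below_four_cuts l'.
Proof. by move=> l'l; apply: le_lt_trans; rewrite lee_fin. Qed.

(** Otherwise (w, x, y, z) would be a 4-cut of length less than m_X. *)
Lemma geodesic_four w x y z : w != x -> x != y -> y != z ->
  below_four_cuts (mdist w x + mdist x y + mdist y z) ->
  mdist w x + mdist x y = mdist w y -> mdist x y + mdist y z = mdist x z ->
  mdist w x + mdist x y + mdist y z = mdist w z.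
Proof.
move=> wx xy yz lt_cut wxy xyz.
have lE : len w [:: x; y; z] = mdist w x + mdist x y + mdist y z.
  by rewrite len_cons len2 addrA.
apply/eqP; rewrite -lE eq_le (mdist_le_len w [:: x; y; z]) andbT leNgt.
apply/negP => lt_wz; move: lt_cut; rewrite /below_four_cuts -lE ltNge => /negP; apply.
apply: ereal_inf_lbound; exists w, x, y, z; split=> //; split=> //.
- by rewrite /is_sequence/= wx xy yz.
- by rewrite lE len2 wxy.
- by rewrite !len2 -wxy -xyz addrA.
Qed.

Lemma is_sequence_cat x s1 s2 :
  is_sequence x (s1 ++ s2) = is_sequence x s1 && is_sequence (last x s1) s2.
Proof. exact: cat_path. Qed.

(* Otherwise y, one of its neighbours and the points next to them would be a  *)
(* 4-cut of length less than m_X.                                             *)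
Lemma singular_points_remove x s1 y z s2 : is_sequence x (s1 ++ y :: z :: s2) ->
  below_four_cuts (len x (s1 ++ y :: z :: s2)) ->
  len (last x s1) [:: y; z] = mdist (last x s1) z ->
  singular_points x (s1 ++ y :: z :: s2) = singular_points x (s1 ++ z :: s2).
Proof.
elim: s1 x => [|p s1 IH] x.
  rewrite !cat0s /= => /and3P[xy yz sq] lt_cut.
  move=> g; rewrite [LHS]singular_points_cons2 g eqxx.
  case: s2 sq lt_cut => [//|z' s2] /= /andP[zz' _] lt_cut.
  rewrite [LHS]singular_points_cons2 [RHS]singular_points_cons2.
  rewrite len2 in g; congr (if _ then _ else _); apply/eqP/eqP; rewrite !len2 => h.
    have := geodesic_four xy yz zz' _ g h; rewrite -g => -> //.
    apply: below_four_cutsW lt_cut; rewrite !len_cons.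
    by have := len_ge0 z' s2; lra.
  have := metric_triangle x y z'; have := metric_triangle y z z'; lra.
rewrite !cat_cons => /= /andP[xp sq] lt_cut g.
have lt_cut' : below_four_cuts (len p (s1 ++ y :: z :: s2)).
  by apply: below_four_cutsW lt_cut; rewrite len_cons lerDr mdist_ge0.
have {IH} := IH p sq lt_cut' g.
case: s1 sq lt_cut lt_cut' g => [|p' s1] sq lt_cut lt_cut' g; last first.
  by rewrite /= => ->.
rewrite !cat0s => ->; rewrite /= in sq lt_cut lt_cut' g.
rewrite len2 in g; case/and3P: sq => py yz _.
congr (if _ then _ else _); apply/eqP/eqP; rewrite !len2 => h.
  have := geodesic_four xp py yz _ h g; rewrite -g addrA => -> //.
  apply: below_four_cutsW lt_cut; rewrite !len_cons.
  by have := len_ge0 z s2; lra.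
have := metric_triangle x y z; have := metric_triangle x p y; lra.
Qed.

(** By [geodesic_skip], the first point that s' omits is smooth and can be deleted by
    [singular_points_remove]; [s1] is the common part already passed. *)
Lemma singular_points_subseq_eq x s1 s s' : subseq s' s ->
  last (last x s1) s' = last (last x s1) s -> is_sequence x (s1 ++ s) ->
  below_four_cuts (len x (s1 ++ s)) -> len (last x s1) s' = len (last x s1) s ->
  singular_points x (s1 ++ s') = singular_points x (s1 ++ s).
Proof.
elim: s s' s1 => [|y s IH] s' s1 /=; first by move=> /eqP ->.
case: s' => [_ _|y' s'] /=.
  rewrite is_sequence_cat /= => /and3P[_ py _] _; rewrite len_nil len_cons.
  have := len_ge0 y s; have : 0 < mdist (last x s1) y by rewrite mdist_gt0.
  by move=> *; exfalso; lra.
case: eqVneq => [-> ss' ls sq lt_cut ll|_ ss' ls sq lt_cut ll].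
  rewrite -!cat_rcons; apply: IH; rewrite ?last_rcons ?cat_rcons//.
  by move: ll; rewrite !len_cons => /addrI.
have [z [s3 [sE g le]]] := geodesic_skip ss' isT ls ll; subst s.
rewrite (singular_points_remove sq lt_cut g).
have len_eq : len x (s1 ++ y :: z :: s3) = len x (s1 ++ z :: s3).
  by rewrite !len_cat -ll le.
apply: IH => //; last by rewrite -len_eq.
move: sq; rewrite !is_sequence_cat /= => /and4P[-> py yz ->]; rewrite andbT /=.
by rewrite -mdist_gt0 -g len2 addr_gt0// mdist_gt0.
Qed.

Lemma singular_points_case x s : singular_points x s = s \/
  exists s1 y z s2, s = s1 ++ y :: z :: s2 /\ len (last x s1) [:: y; z] = mdist (last x s1) z.
Proof.
elim: s x => [|y [|z s] IH] x; [by left|by left|].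
rewrite [singular_points _ _]/=; case: eqP => [g|_].
  by right; exists [::], y, z, s.
have [/= ->|[s1 [y' [z' [s2 [-> g]]]]]] := IH y; first by left.
by right; exists (y :: s1), y', z', s2.
Qed.

(** Smooth points are deleted one at a time, which changes neither the length nor the remaining
    singular points, until none is left. *)
Lemma singular_points_spec x s : is_sequence x s -> below_four_cuts (len x s) ->
  singular_sequence x (singular_points x s) /\ len x (singular_points x s) = len x s.
Proof.
have [n] := ubnP (size s); elim: n s => // n IH s sn sq lt_cut.
have [sE|[s1 [y [z [s2 [sE g]]]]]] := singular_points_case x s.
  by split; [apply/singular_sequenceP; rewrite !sE|rewrite sE].
subst s; have len_eq : len x (s1 ++ y :: z :: s2) = len x (s1 ++ z :: s2).
  by rewrite !len_cat; congr (_ + _); move: g; rewrite !len_cons len_nil; lra.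
rewrite (singular_points_remove sq lt_cut g) len_eq; apply: IH.
- by move: sn; rewrite !size_cat /=; rewrite !addnS ltnS.
- move: sq; rewrite !is_sequence_cat /= => /and4P[-> py yz ->]; rewrite andbT /=.
  by rewrite -mdist_gt0 -g len2 addr_gt0// mdist_gt0.
- by rewrite -len_eq.
Qed.

End frames.

(** * Causal chains *)

Section finite_chains.
Context {disp : Order.disp_t} {T : porderType disp}.
Implicit Types (P : set T) (u v w : T) (c : seq T) (s t : {fset T}).

Lemma simplexE v c u : (u \in simplex v c) = (u \in v :: c).
Proof. by rewrite !inE. Qed.

Lemma path_ends v c u : path <%O v c -> u \in v :: c -> (v <= u)%O /\ (u <= last v c)%O.
Proof.
elim: c v u => [|w c IH] v u /=; first by move=> _; rewrite inE => /eqP ->.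
move=> /andP[vw pc]; rewrite inE => /predU1P[->|/(IH _ _ pc)[wu ul]]; split=> //.
  by apply: le_trans (ltW vw) _; have [] := IH w w pc (mem_head _ _).
exact: le_trans (ltW vw) wu.
Qed.

Lemma path_total v c u w : path <%O v c -> u \in v :: c -> w \in v :: c ->
  (u <= w)%O || (w <= u)%O.
Proof.
elim: c v => [|x c IH] v; first by rewrite /= !inE => _ /eqP -> /eqP ->; rewrite lexx.
move=> pc; have [/= _ pxc] := andP (pc : _ && _).
rewrite ![_ \in v :: _]in_cons => /predU1P[-> wc|uc /predU1P[->|wc]].
- by have [-> _] := path_ends pc (wc : w \in v :: x :: c).
- have uc' : u \in v :: x :: c by rewrite inE uc orbT.
  by have [-> _] := path_ends pc uc'; rewrite orbT.
- exact: IH pxc uc wc.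
Qed.

Lemma chain_unique v c v' c' : path <%O v c -> path <%O v' c' ->
  {subset simplex v c <= simplex v' c'} -> {subset simplex v' c' <= simplex v c} ->
  v = v' /\ c = c'.
Proof.
move=> pc pc' s1 s2; have [] // : v :: c = v' :: c'.
apply: lt_sorted_eq => // u; apply/idP/idP; rewrite -!simplexE; [exact: s1|exact: s2].
Qed.

Lemma chain_subseq v c v' c' : path <%O v c -> path <%O v' c' ->
  {subset v' :: c' <= v :: c} -> subseq (v' :: c') (v :: c).
Proof.
move=> pc pc' sub; have -> : v' :: c' = [seq u <- v :: c | u \in v' :: c'].
  apply: lt_sorted_eq => //; first exact: lt_sorted_filter.
  by move=> u; rewrite mem_filter; case: (boolP (u \in v' :: c')) => //= /sub.
exact: filter_subseq.
Qed.

(** Sorting a finite totally ordered set recovers the chain. This form without lists suits faces and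
    gluing. *)
Lemma order_complexP P s : order_complex P s <->
  [/\ s != fset0, forall u, u \in s -> P u &
      forall u w, u \in s -> w \in s -> (u <= w)%O || (w <= u)%O].
Proof.
split=> [[v [c [[pc cP] ->]]]|[s0 sP stot]].
  split; first by apply/fset0Pn; exists v; rewrite simplexE mem_head.
  - by move=> u; rewrite simplexE; exact: cP.
  - by move=> u w; rewrite !simplexE; exact: path_total.
have mem_r u : (u \in sort <=%O s) = (u \in s) by rewrite mem_sort.
have : sorted <%O (sort <=%O s).
  rewrite lt_sorted_uniq_le sort_uniq fset_uniq /=.
  by apply: (@sort_sorted_in _ (mem s)) => //; apply/allP.
case: (sort _ _) mem_r => [|v c] mem_r pc.
  by have [u] := fset0Pn _ s0; rewrite -mem_r.
exists v, c; split; first by split=> // u; rewrite mem_r; exact: sP.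
by apply/fsetP => u; rewrite simplexE mem_r.
Qed.

Lemma order_complex_face P s t : order_complex P s -> (t `<=` s)%fset -> t != fset0 ->
  order_complex P t.
Proof.
move=> /order_complexP[_ sP stot] /fsubsetP ts t0; apply/order_complexP; split=> //.
  by move=> u /ts; exact: sP.
by move=> u w /ts us /ts; exact: stot.
Qed.

End finite_chains.

(** * Events, light-like chains and their frames *)

Section events.
Context {R : realType} {X : metricType R}.
Implicit Types (x y z a b : X) (s f : seq X) (t l : R) (u v w : event X) (c : seq (event X)).

Lemma causal_leE u v : (u <= v)%O = (mdist u.1 v.1 <= v.2 - u.2).
Proof. by []. Qed.

Lemma causal_lt_time u v : (u < v)%O -> u.2 < v.2.
Proof.
rewrite lt_neqAle causal_leE => /andP[uv le_uv]; rewrite lt_neqAle -subr_ge0.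
rewrite (le_trans (mdist_ge0 _ _) le_uv) andbT; apply: contra uv => /eqP uv2.
move: le_uv; rewrite uv2 subrr => uv1.
have {uv1} : u.1 = v.1 by apply: mdist_positivity; apply/eqP; rewrite eq_le uv1 mdist_ge0.
by case: u v uv2 => [x t] [y r] /= -> ->.
Qed.

Lemma CauP l a b u : Cau l a b u <->
  (((a, 0) : event X) <= u)%O /\ (u <= ((b, l) : event X))%O.
Proof.
rewrite !causal_leE /= subr0; split=> [[_ ? ?]|[au ub]]; split=> //.
rewrite in_itv /= (le_trans (mdist_ge0 _ _) au)/= -subr_ge0.
exact: le_trans (mdist_ge0 _ _) ub.
Qed.

(** The light-like chain over s after the event (x, t): each step lasts exactly its distance. *)
Fixpoint timed t x s : seq (event X) :=
  if s is y :: s' then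
    ((y, t + mdist x y) : event X) :: timed (t + mdist x y) y s'
  else [::].

Lemma timed_fst t x s : [seq u.1 | u <- timed t x s] = s.
Proof. by elim: s t x => //= y s IH t x; rewrite IH. Qed.

Lemma last_timed t x s : last ((x, t) : event X) (timed t x s) = (last x s, t + len x s).
Proof.
elim: s t x => [|y s IH] t x /=; first by rewrite len_nil addr0.
by rewrite IH len_cons addrA.
Qed.

Lemma timed_path t x s : is_sequence x s -> path <%O ((x, t) : event X) (timed t x s).
Proof.
elim: s t x => //= y s IH t x /andP[xy /IH ->]; rewrite andbT.
rewrite lt_neqAle causal_leE /= addrAC subrr add0r lexx andbT.
by apply: contra xy => /eqP[-> _].
Qed.

Lemma nth_timed t x s j : (j <= size s)%N ->
  nth ((x, t) : event X) ((x, t) :: timed t x s) j = (nth x (x :: s) j, t + len x (take j s)).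
Proof.
elim: s t x j => [|y s IH] t x [|j] //=; rewrite ?len_nil ?addr0// ltnS => js.
have st : (j < (size (timed (t + mdist x y)%R y s)).+1)%N.
  by rewrite -(size_map fst) timed_fst ltnS.
set r := t + mdist x y.
rewrite (@set_nth_default _ ((y, r) :: timed r y s) (y, r) (x, t) _ st) IH//.
rewrite len_cons addrA.
by congr (_, _); apply: set_nth_default.
Qed.

(** With equal lengths, each omitted point lies between its neighbours ([geodesic_skip]), so its
    omission does not alter the later times. *)
Lemma timed_subseq t x s f : subseq f s -> last x f = last x s -> len x f = len x s ->
  subseq (timed t x f) (timed t x s).
Proof.
elim: s t x f => [|y s IH] t x f; first by rewrite subseq0 => /eqP ->.
case: f => [|y' f]; first by rewrite sub0seq.
rewrite [subseq _ _]/=; case: eqVneq => [->|_] fs lf le_f.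
  by rewrite /= eqxx; apply: IH => //; move: le_f; rewrite !len_cons => /addrI.
have [z [s3 [sE g le_s]]] := geodesic_skip fs isT lf le_f; subst s.
have -> : timed t x (y :: z :: s3) = (y, t + mdist x y) :: timed t x (z :: s3).
  by rewrite /= -addrA; move: g; rewrite len2 => ->.
by apply: subseq_trans (subseq_cons _ _); apply: IH.
Qed.

Lemma len_chain_le v c : path <%O v c ->
  len v.1 [seq u.1 | u <- c] <= (last v c).2 - v.2.
Proof.
elim: c v => [|u c IH] v /=; first by rewrite len_nil subrr.
move=> /andP[/ltW]; rewrite causal_leE len_cons => vu /IH; lra.
Qed.

Lemma lightlike v c : path <%O v c ->
  (last v c).2 - v.2 <= len v.1 [seq u.1 | u <- c] ->
  c = timed v.2 v.1 [seq u.1 | u <- c] /\ is_sequence v.1 [seq u.1 | u <- c].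
Proof.
elim: c v => //= u c IH v /andP[vu pc]; rewrite len_cons => le_c.
have := len_chain_le pc; have := ltW vu; rewrite causal_leE => le_vu le_uc.
have u2 : u.2 = v.2 + mdist v.1 u.1 by lra.
have [cE ->] := IH u pc ltac:(lra); rewrite andbT; split.
  by rewrite -u2 -cE; case: (u).
rewrite -mdist_gt0; have := causal_lt_time vu; lra.
Qed.

(** The time between the end events is at most l - d(a, x_0) - d(x_n, b) and at least the length; a
    length of at least l leaves no slack anywhere. *)
Lemma long_chain l a b v c : chain_in (Cau l a b) v c -> l <= len v.1 [seq u.1 | u <- c] ->
  let s := [seq u.1 | u <- c] in
  [/\ v = (a, 0), c = timed 0 a s, is_sequence a s, last a s = b & len a s = l].
Proof.
move=> [pc cC] le_l.
have [_ av _] := cC v (mem_head _ _).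
have [lin _ lb] := cC (last v c) (mem_last _ _).
have le1 := len_chain_le pc; have d1 := mdist_ge0 a v.1; have d2 := mdist_ge0 (last v c).1 b.
have v2 : v.2 = 0 by lra.
have l2 : (last v c).2 = l by lra.
have v1 : v.1 = a.
  by apply/esym/mdist_positivity; apply/eqP; rewrite eq_le mdist_ge0 andbT -v2.
have lb1 : (last v c).1 = b.
  by apply/mdist_positivity; apply/eqP; rewrite eq_le mdist_ge0 andbT; lra.
have [] := lightlike pc ltac:(lra); rewrite v1 v2 => cE sq /=; split=> //.
- by rewrite -v1 -v2; case: (v).
- by rewrite -v1 last_map lb1.
- by rewrite v1 in le1 le_l; lra.
Qed.

Lemma timed_chain l a b s : is_sequence a s -> last a s = b -> len a s = l ->
  chain_in (Cau l a b) (a, 0) (timed 0 a s).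
Proof.
move=> sq sb sl; have pc := timed_path 0 sq; split=> // u /(path_ends pc)[au ub].
by apply/CauP; split=> //; move: ub; rewrite last_timed add0r sb sl.
Qed.

(** A simplex determines its chain ([chain_unique]), hence its length; the long ones are described
    by [long_chain]. *)
Lemma not_shortP l a b (s : {fset event X}) : order_complex (Cau l a b) s ->
  ~ short_chains l a b s <-> exists xs,
    [/\ s = simplex ((a, 0) : event X) (timed 0 a xs), is_sequence a xs,
        last a xs = b & len a xs = l].
Proof.
move=> [v [c [cC sE]]]; split=> [ns|[xs [sE' sq xb xl]] [v' [c' [[pc' _] sE'' lt_l]]]].
  have [|vE cE sq lb le_l] := long_chain cC.
    by rewrite leNgt; apply/negP => lt_l; apply: ns; exists v, c.
  by exists [seq u.1 | u <- c]; rewrite sE vE -cE.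
have [] := chain_unique pc' (timed_path 0 sq); rewrite -?sE' -?sE''//.
by move=> v'E c'E; move: lt_l; rewrite v'E c'E timed_fst /= xl ltxx.
Qed.

Lemma short_order l a b (s : {fset event X}) : short_chains l a b s -> order_complex (Cau l a b) s.
Proof. by move=> [v [c [? ? _]]]; exists v, c. Qed.

Lemma framedP a f (s : {fset event X}) : framed_simplices a f s <-> exists xs,
    [/\ s = simplex ((a, 0) : event X) (timed 0 a xs), is_sequence a xs, last a xs = last a f,
        len a xs = len a f & singular_points a xs = f].
Proof.
split=> [[v [c [cC -> sq]]]|[xs [-> sq xl xlen xf]]].
  rewrite frameE => -[va fE].
  have lastE : last a [seq u.1 | u <- c] = last a f by rewrite -fE -va last_singular_points.
  have [|vE cE _ lb le_l] := long_chain cC.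
    rewrite va -fE va; have := len_subseq a (singular_points_subseq a [seq u.1 | u <- c]).
    by rewrite last_singular_points mdistxx addr0.
  exists [seq u.1 | u <- c]; split=> //; first by rewrite vE {1}cE.
  - by rewrite -va.
  - by rewrite -va.
exists ((a, 0) : event X), (timed 0 a xs).
by split; rewrite ?timed_fst//; [exact: timed_chain|rewrite frameE xf].
Qed.

Lemma framed_order a f (s : {fset event X}) : framed_simplices a f s ->
  order_complex (Cau (len a f) a (last a f)) s.
Proof. by move=> [v [c [? ? _ _]]]; exists v, c. Qed.

Lemma framed_not_short a f (s : {fset event X}) : framed_simplices a f s ->
  ~ short_chains (len a f) a (last a f) s.
Proof.
move=> sf; apply/(not_shortP (framed_order sf)).
by have [xs [? ? ? ? _]] := (framedP a f s).1 sf; exists xs.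
Qed.

(** The ends of a long chain are the least and greatest events of [Cau], so they are also the ends
    of every chain containing it. *)
Lemma fsubset_long l a b v c xs : chain_in (Cau l a b) v c -> is_sequence a xs ->
  last a xs = b -> len a xs = l ->
  {subset ((a, 0) : event X) :: timed 0 a xs <= v :: c} ->
  [/\ v = (a, 0), subseq (timed 0 a xs) c & last v c = (b, l)].
Proof.
move=> [pc cC] sq xb xl sub.
have vE : v = (a, 0).
  apply/eqP; rewrite eq_le; have /CauP[-> _] := cC v (mem_head _ _); rewrite andbT.
  by have [] := path_ends pc (sub _ (mem_head _ _)).
have lE : last v c = (b, l).
  have /CauP[_ ll] := cC (last v c) (mem_last _ _).
  apply/eqP; rewrite eq_le ll /=.
  have := sub _ (mem_last _ _); rewrite last_timed xb xl add0r.
  by move=> /(path_ends pc)[].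
split=> //; have := chain_subseq pc (timed_path 0 sq) sub.
by rewrite vE /= eqxx.
Qed.

(** A chain with a long face is at least as long as that face, by [len_subseq]. *)
Lemma short_face l a b (s t : {fset event X}) : short_chains l a b s ->
  order_complex (Cau l a b) t -> (t `<=` s)%fset -> short_chains l a b t.
Proof.
move=> [v [c [cC sE lt_l]]] ot /fsubsetP ts; apply: contrapT => /(not_shortP ot).
move=> [xs [tE sq xb xl]].
have [|vE /(map_subseq fst)] := fsubset_long cC sq xb xl.
  by move=> u; rewrite -!simplexE -tE -sE; exact: ts.
rewrite timed_fst => /(len_subseq a) + lE; rewrite xb xl.
move: lt_l; rewrite vE /= => lt_l.
have -> : last a (map fst c) = b.
  by have := congr1 fst lE; rewrite -last_map vE.
by rewrite mdistxx addr0 leNgt lt_l.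
Qed.

Lemma framed_face a f (s t : {fset event X}) : below_four_cuts (X := X) (len a f) ->
  framed_simplices a f s -> order_complex (Cau (len a f) a (last a f)) t ->
  (t `<=` s)%fset -> framed_simplices a f t \/ short_chains (len a f) a (last a f) t.
Proof.
move=> lt_cut sf ot /fsubsetP ts.
have [st|/(not_shortP ot)[xs' [tE sq' xb' xl']]] := pselect (short_chains (len a f) a (last a f) t).
  by right.
left; have /framedP[xs [sE sq xb xl xf]] := sf.
apply/framedP; exists xs'; split=> //.
have [|_ /(map_subseq fst) + _] := fsubset_long (timed_chain sq xb xl) sq' xb' xl'.
  by move=> u; rewrite -!simplexE -tE -sE; exact: ts.
rewrite !timed_fst -xf => sub.
by apply: (@singular_points_subseq_eq _ _ a [::]); rewrite ?xl ?xl' ?xb ?xb'.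
Qed.

(** Conversely, a chain through all the marks is at least as long as F, hence light-like of the same
    length; F being a subsequence of it, both have the same singular points, those of F. *)
Lemma framed_marksP a f (s : {fset event X}) : singular_sequence a f ->
  below_four_cuts (X := X) (len a f) ->
  framed_simplices a f s <-> order_complex (Cau (len a f) a (last a f)) s /\
    {subset ((a, 0) : event X) :: timed 0 a f <= s}.
Proof.
move=> /singular_sequenceP[sqf ff] lt_cut; split=> [sf|[os sub]].
  split; first exact: framed_order.
  have /framedP[xs [-> sq xb xl xf]] := sf.
  move=> u; rewrite simplexE !inE => /predU1P[->|uf]; first by rewrite eqxx.
  apply/orP; right; apply: (mem_subseq _ uf); apply: timed_subseq => //.
  by rewrite -{1}xf; exact: singular_points_subseq.
have [v [c [cC sE]]] := os.
have [|vE /(map_subseq fst) + lE] := fsubset_long cC sqf erefl erefl.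
  by move=> u /sub; rewrite sE simplexE.
rewrite timed_fst => fc.
have lastE : last a [seq u.1 | u <- c] = last a f.
  by have := congr1 fst lE; rewrite -last_map vE.
have [|_ cE sq _ xl] := long_chain cC.
  by rewrite vE; have := len_subseq a fc; rewrite lastE mdistxx addr0.
apply/framedP; exists [seq u.1 | u <- c]; rewrite -cE -vE; split=> //.
rewrite -[RHS]ff; apply/esym; apply: (@singular_points_subseq_eq _ _ a [::]) => //.
by rewrite cat0s xl.
Qed.

(** With l = d(a, b), every chain from one end to the other has length at least l, while a chain
    that is not short contains both ends. *)
Lemma short_endsP a b (s : {fset event X}) : order_complex (Cau (mdist a b) a b) s ->
  short_chains (mdist a b) a b s <->
    ~ (((a, 0) : event X) \in s /\ ((b, mdist a b) : event X) \in s).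
Proof.
move=> os; split=> [[v [c [[pc cC] sE lt_l]]] [sa sb]|nab].
  have vE : v = (a, 0).
    apply/eqP; rewrite eq_le; have /CauP[-> _] := cC v (mem_head _ _); rewrite andbT.
    by move: sa; rewrite sE simplexE => /(path_ends pc)[].
  have lE : last v c = (b, mdist a b).
    have /CauP[_ ll] := cC (last v c) (mem_last _ _).
    apply/eqP; rewrite eq_le ll /=.
    by move: sb; rewrite sE simplexE => /(path_ends pc)[].
  have := mdist_le_len a [seq u.1 | u <- c].
  have -> : last a [seq u.1 | u <- c] = b by have := congr1 fst lE; rewrite -last_map vE.
  by rewrite leNgt; move: lt_l; rewrite vE => ->.
apply: contrapT => /(not_shortP os)[xs [sE sq xb xl]]; apply: nab.
rewrite sE !simplexE mem_head; split=> //.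
by have := mem_last ((a, 0) : event X) (timed 0 a xs); rewrite last_timed xb xl add0r.
Qed.

End events.

Lemma homeomorphic_homotopy_equivalent (R : realType) (T U : ptopologicalType) :
  homeomorphic T U -> homotopy_equivalent R T U.
Proof.
move=> [f [g [pf pg fK gK]]]; exists f, g; split=> //.
- exists fst; split=> [|x|x|t _] //=.
  by apply: continuous_subspaceT => p; exact: cvg_fst.
- exists fst; split=> [|x|x|t _] //=.
  by apply: continuous_subspaceT => p; exact: cvg_fst.
Qed.

(** * The wedge over frames and the smash product over intervals *)

Section frame_intervals.
Context {R : realType} {X : metricType R}.
Implicit Types (a b : X) (f : seq X) (l : R).

Lemma magnitude_wedge a b l : below_four_cuts (X := X) l ->
  homeomorphic (magnitude_type l a b)
    (wedge_sum (fun f : set_type (singular_sequences l a b) =>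
                  framed_magnitude_type a (val f))).
Proof.
move=> lt_cut; pose S (f : set_type (singular_sequences l a b)) := framed_simplices a (val f).
have fP (f : set_type (singular_sequences l a b)) :
    [/\ singular_sequence a (val f), len a (val f) = l & last a (val f) = b].
  exact: set_mem (valP f).
(* Writing l and b for the length and the end of each frame gives all summands the same collapsed
   subcomplex. *)
have -> : (fun f : set_type (singular_sequences l a b) => framed_magnitude_type a (val f)) =
    (fun f : set_type (singular_sequences l a b) =>
       relative_realization R (S f `|` short_chains l a b) (short_chains l a b)).
  apply/funext => f; rewrite /framed_magnitude_type /=.
  by have [_ -> ->] := fP f.
apply: wedge_homeomorphic.
- exact: short_order.
- by move=> f s /framed_order; have [_ -> ->] := fP f.
- by move=> f s /framed_not_short; have [_ -> ->] := fP f.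
- move=> f g s /framedP[xs [sE sq _ _ xf]] /framedP[xs' [sE' sq' _ _ xg]].
  apply: val_inj; rewrite -xf -xg.
  have [||_ tE] := chain_unique (timed_path 0 sq) (timed_path 0 sq'); rewrite -?sE -?sE'//.
  by have := congr1 (map fst) tE; rewrite !timed_fst => ->.
(* A surviving chain belongs to the class of its own frame. *)
- move=> s os; have [|/(not_shortP os)[xs [sE sq xb xl]]] := pselect (short_chains l a b s).
    by left.
  right; have [|sg xl'] := singular_points_spec sq; first by rewrite xl.
  have fS : singular_points a xs \in singular_sequences l a b.
    by apply/mem_set; split; rewrite ?xl' ?last_singular_points.
  exists (SigSub fS); apply/framedP; exists xs.
  by split=> //=; rewrite ?xl' ?last_singular_points.
- by move=> s t ss ot ts; exact: short_face ss ot ts.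
- move=> f s t; rewrite /S; have [_ fl fb] := fP f => sf ot ts.
  have := @framed_face _ _ a (val f) s t; rewrite fl fb; exact.
Qed.

(** Moves the causal interval of two consecutive points of F, which starts at time 0, to its place
    between two marks. *)
Definition shift (r : R) (u : event X) : event X := (u.1, u.2 + r).

Lemma shift_le r u v : (shift r u <= shift r v)%O = (u <= v)%O.
Proof. by rewrite !causal_leE /shift /= opprD addrACA subrr addr0. Qed.

Lemma shiftK r : cancel (shift r) (shift (- r)).
Proof. by move=> [x t]; rewrite /shift /= addrK. Qed.

Lemma shiftNK r : cancel (shift (- r)) (shift r).
Proof. by move=> [x t]; rewrite /shift /= subrK. Qed.

Variables (a : X) (f : seq X).
Hypotheses (sing : singular_sequence a f) (lt_cut : below_four_cuts (X := X) (len a f))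
  (len_gt0 : 0 < len a f).

Let m := size f.
Let b := last a f.
Let pt j := nth a (a :: f) j.
Let time j := len a (take j f).
Let mark j : event X := (pt j, time j).
Let dist (i : 'I_m) := mdist (nth a (a :: f) i) (nth a f i).
Let S := framed_simplices a f.
Let L := short_chains (len a f) a b.
Let K_ (i : 'I_m) := order_complex (Cau (dist i) (nth a (a :: f) i) (nth a f i)).
Let L_ (i : 'I_m) := short_chains (dist i) (nth a (a :: f) i) (nth a f i).
Let al (i : 'I_m) : event X := (nth a (a :: f) i, 0).
Let be (i : 'I_m) : event X := (nth a f i, dist i).

Let m_gt0 : (0 < m)%N.
Proof.
by rewrite lt0n size_eq0; apply: contraTneq len_gt0 => ->; rewrite len_nil ltxx.
Qed.

Let timeS (i : 'I_m) : time i.+1 = time i + dist i.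
Proof.
rewrite /time (take_nth a (ltn_ord i)) -cats1 len_cat len_cons len_nil addr0.
congr (_ + mdist _ _); rewrite (last_nth a) size_takel; last exact/ltnW/ltn_ord.
rewrite -{2}(cat_take_drop i f) -cat_cons nth_cat /=.
by rewrite size_takel ?ltnS ?leqnn//; exact/ltnW/ltn_ord.
Qed.

Let dist_gt0 (i : 'I_m) : 0 < dist i.
Proof.
have [/(pathP a)/(_ i (ltn_ord i)) sq _] := sing.
by rewrite mdist_gt0.
Qed.

Let mark0 : mark 0 = (a, 0).
Proof. by rewrite /mark /pt /time take0 len_nil. Qed.

Let markm : mark m = (b, len a f).
Proof. by rewrite /mark /pt /time take_size /b (last_nth a). Qed.

Let mem_marks u : u \in ((a, 0) : event X) :: timed 0 a f <-> exists2 j, (j <= m)%N & u = mark j.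
Proof.
have st : size (timed 0 a f) = m by rewrite -(size_map fst) timed_fst.
have E j : (j <= m)%N -> nth ((a, 0) : event X) (((a, 0) : event X) :: timed 0 a f) j = mark j.
  by move=> jm; rewrite nth_timed// add0r.
split=> [/(nthP ((a, 0) : event X))[j]|[j jm ->]].
  by rewrite [size _]/= st ltnS => jm <-; exists j => //; exact: E.
by rewrite -E//; apply: mem_nth; rewrite /= st ltnS.
Qed.

Let shift_al (i : 'I_m) : shift (time i) (al i) = mark i.
Proof. by rewrite /shift /= add0r. Qed.

Let shift_be (i : 'I_m) : shift (time i) (be i) = mark i.+1.
Proof. by rewrite /shift /= addrC -timeS. Qed.

Let CauE (i : 'I_m) u : Cau (dist i) (nth a (a :: f) i) (nth a f i) u <->
  (mark i <= shift (time i) u)%O /\ (shift (time i) u <= mark i.+1)%O.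
Proof. by rewrite -shift_al -shift_be !shift_le; exact: CauP. Qed.

Let Cau_al (i : 'I_m) : Cau (dist i) (nth a (a :: f) i) (nth a f i) (al i).
Proof. by apply/CauP; rewrite lexx causal_leE /= subr0. Qed.

Let Cau_be (i : 'I_m) : Cau (dist i) (nth a (a :: f) i) (nth a f i) (be i).
Proof. by apply/CauP; rewrite lexx causal_leE /= subr0. Qed.

Let mark_ltS (i : 'I_m) : (mark i < mark i.+1)%O.
Proof.
rewrite lt_neqAle; apply/andP; split; last by rewrite causal_leE /= timeS addrAC subrr add0r.
apply/eqP => /(congr1 snd)/= /eqP; rewrite timeS -subr_eq0 opprD addrA subrr add0r oppr_eq0.
by rewrite gt_eqF.
Qed.

Let mark_le j k : (j <= k)%N -> (k <= m)%N -> (mark j <= mark k)%O.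
Proof.
move=> + km; elim: k km => [|k IH] km; first by rewrite leqn0 => /eqP ->.
rewrite leq_eqVlt => /predU1P[->//|]; rewrite ltnS => /(IH (ltnW km)) jk.
exact: le_trans jk (ltW (mark_ltS (Ordinal km))).
Qed.

Let mark_inj j k : (j <= k)%N -> (k <= m)%N -> (mark k <= mark j)%O -> j = k.
Proof.
rewrite leq_eqVlt => /predU1P[//|jk] km kj.
have jm := leq_trans jk km.
have := lt_le_trans (mark_ltS (Ordinal jm)) (le_trans (mark_le jk km) kj).
by rewrite ltxx.
Qed.

Let SP s : S s <-> order_complex (Cau (len a f) a b) s /\ forall j, (j <= m)%N -> mark j \in s.
Proof.
rewrite /S (framed_marksP _ sing lt_cut); split=> -[os h]; split=> //.
  by move=> j jm; apply: h; apply/mem_marks; exists j.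
by move=> u /mem_marks[j jm ->]; exact: h.
Qed.

Let K_order s : (S `|` L) s -> order_complex (Cau (len a f) a b) s.
Proof. by move=> [/framed_order|/short_order]. Qed.

Let not_short_S s : (S `|` L) s -> ~ L s -> S s.
Proof. by case. Qed.

Let short_marks s : (S `|` L) s -> L s <-> exists2 j, (j <= m)%N & mark j \notin s.
Proof.
move=> Ks; split=> [Ls|[j jm js]].
  apply: contrapT => nj; have : S s.
    apply/SP; split=> [|j jm]; first exact: K_order.
    by apply: contrapT => /negP js; apply: nj; exists j.
  by move=> /framed_not_short; exact.
case: Ks => // /SP[_ /(_ j jm)].
by rewrite (negbTE js).
Qed.

Let face_K : face_closed (S `|` L).
Proof.
move=> s t Ks ts t0; have ot := order_complex_face (K_order Ks) ts t0.
case: Ks => [Ss|Ls]; first exact: framed_face lt_cut Ss ot ts.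
by right; exact: short_face Ls ot ts.
Qed.

Let K_split s v : (S `|` L) s -> ~ L s -> v \in s -> exists i u,
  Cau (dist i) (nth a (a :: f) i) (nth a f i) u /\ v = shift (time i) u.
Proof.
move=> Ks nLs vs; have /SP[os ms] := not_short_S Ks nLs.
have /order_complexP[_ sC stot] := os.
have /CauP[v0 vm] := sC _ vs; rewrite -mark0 in v0; rewrite -markm in vm.
suff [i iv] : exists i : 'I_m, (mark i <= v)%O /\ (v <= mark i.+1)%O.
  exists i, (shift (- time i) v); rewrite shiftNK; split=> //.
  by apply/CauE; rewrite shiftNK.
(* The induction finds the first mark above v; the marks and v belong to one chain, so they are
   comparable. *)
suff H k : (0 < k)%N -> (k <= m)%N -> (v <= mark k)%O ->
  exists i : 'I_m, (mark i <= v)%O /\ (v <= mark i.+1)%O by exact: (H m m_gt0).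
elim: k => // k IH _ km vk.
case: k IH km vk => [|k] IH km vk; first by exists (Ordinal km).
have /orP[vk'|kv] := stot v (mark k.+1) vs (ms k.+1 (ltnW km)).
  exact: IH (ltnW km) vk'.
by exists (Ordinal km).
Qed.

Let K_preim (s : {fset event X}) i (t : {fset event X}) : (S `|` L) s -> ~ L s -> t != fset0 ->
  (forall u, u \in t -> Cau (dist i) (nth a (a :: f) i) (nth a f i) u /\ shift (time i) u \in s) ->
  K_ i t.
Proof.
move=> /K_order/order_complexP[_ _ stot] _ t0 ts; apply/order_complexP; split=> //.
  by move=> u /ts[].
by move=> u w /ts[_ us] /ts[_ ws]; have := stot _ _ us ws; rewrite !shift_le.
Qed.

(** The pieces are not short, so they contain their ends ([short_endsP]) and s contains all the
    marks. Events of different pieces are comparable through a mark between them. *)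
Let K_glue (t : 'I_m -> {fset event X}) : (forall i, K_ i (t i) /\ ~ L_ i (t i)) ->
  forall s : {fset event X},
  (forall v, v \in s <-> exists i u, u \in t i /\ v = shift (time i) u) ->
  (S `|` L) s.
Proof.
move=> tP s sE; left; apply/SP.
have tends i : al i \in t i /\ be i \in t i.
  have [Kt nLt] := tP i; apply: contrapT => nab; apply: nLt.
  exact/(short_endsP Kt).
have ms j : (j <= m)%N -> mark j \in s.
  rewrite leq_eqVlt => /predU1P[->|jm]; last first.
    apply/sE; exists (Ordinal jm), (al (Ordinal jm)); split; first exact: (tends _).1.
    by rewrite shift_al.
  (* The last mark is the left end of no piece; it is the right end of the last one. *)
  have pm : (m.-1 < m)%N by rewrite prednK.
  apply/sE; exists (Ordinal pm), (be (Ordinal pm)); split; first exact: (tends _).2.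
  by rewrite shift_be /= prednK.
have bounds i u : u \in t i -> (mark i <= shift (time i) u)%O /\ (shift (time i) u <= mark i.+1)%O.
  by have [/order_complexP[_ tC _] _] := tP i; move=> /tC/CauE.
split=> //; apply/order_complexP; split.
- by apply/fset0Pn; exists (mark 0); exact: ms.
- move=> v /sE[i [u [ut ->]]]; have [h1 h2] := bounds i u ut.
  apply/CauP; rewrite -mark0 -markm; split.
    by apply: le_trans h1; apply: mark_le => //; exact/ltnW/ltn_ord.
  by apply: le_trans h2 _; apply: mark_le.
- move=> v w /sE[i [u [ut ->]]] /sE[j [x [xt ->]]].
  have [h1 h2] := bounds i u ut; have [h3 h4] := bounds j x xt.
  have [ij|ji|/val_inj ij] := ltngtP i j.
  + rewrite (le_trans h2 (le_trans _ h3))//; apply: mark_le => //; exact/ltnW/ltn_ord.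
  + rewrite orbC (le_trans h4 (le_trans _ h1))//; apply: mark_le => //; exact/ltnW/ltn_ord.
  + subst j; rewrite !shift_le; have [/order_complexP[_ _ ttot] _] := tP i.
    exact: ttot.
Qed.

(** A common event lies above mark j and below mark i+1, where i+1 <= j; so the two marks coincide
    with it. *)
Let overlap (i j : 'I_m) u v : (i < j)%N -> Cau (dist i) (nth a (a :: f) i) (nth a f i) u ->
  Cau (dist j) (nth a (a :: f) j) (nth a f j) v -> shift (time i) u = shift (time j) v ->
  [/\ u = be i, v = al j & j = i.+1 :> nat].
Proof.
move=> ij /CauE[_ u1] /CauE[v1 _] uv.
have jm := ltnW (ltn_ord j).
have ji : i.+1 = j.
  by apply: mark_inj => //; apply: le_trans v1 _; rewrite -uv.
split=> //.
  apply: (can_inj (shiftK (time i))); apply/eqP; rewrite shift_be eq_le u1 /=.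
  by rewrite ji uv.
apply: (can_inj (shiftK (time j))); apply/eqP; rewrite shift_al eq_le v1 andbT.
by rewrite -uv -ji.
Qed.

Lemma framed_smash : homeomorphic (framed_magnitude_type a f)
  (smash (fun i : 'I_(size f) =>
     magnitude_type (mdist (nth a (a :: f) i) (nth a f i)) (nth a (a :: f) i) (nth a f i))).
Proof.
apply: (@glue_homeomorphic R _ m (S `|` L) L K_ L_ (fun i => shift (time i))
  (fun i => shift (- time i)) (fun i => Cau (dist i) (nth a (a :: f) i) (nth a f i))
  mark al be) => //.
- by move=> i; exact: shiftK.
- by move=> i; exact: shiftNK.
- by move=> i s t; exact: order_complex_face.
- by move=> s t Ls Kt ts; exact: short_face Ls (K_order Kt) ts.
- by move=> i s v /order_complexP[_ + _]; exact.
- by move=> i s; exact: short_endsP.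
Qed.

End frame_intervals.

Theorem theorem4p33 (R : realType) (X : metricType R) :
  (forall (a b : X) (l : R),
     0 < l -> (l%:E < four_cut_inf X)%E -> mdist a b <= l ->
     homeomorphic (magnitude_type l a b)
       (wedge_sum (fun f : set_type (singular_sequences l a b) =>
                     framed_magnitude_type a (val f))))
  /\
  (forall (a : X) (f : seq X),
     singular_sequence a f -> 0 < len a f -> ((len a f)%:E < four_cut_inf X)%E ->
     homotopy_equivalent R (framed_magnitude_type a f)
       (smash (fun i : 'I_(size f) =>
                 magnitude_type (mdist (nth a (a :: f) i) (nth a f i))
                   (nth a (a :: f) i) (nth a f i)))).
Proof.
split=> [a b l _ lt_cut _|a f sing len_gt0 lt_cut]; first exact: magnitude_wedge.
exact/homeomorphic_homotopy_equivalent/framed_smash.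
Qed.
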